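(* Let $(G,H,\Phi)$ be a morphism Lie group and let $(V,W,\psi)$ be a module over it. Then the collection of maps $\mathrm{vE}:C^n_{\mathsf{mLG},d}(\Phi,\psi)\to C^n_{\mathsf{mLA}}(\mathrm{Lie}(\Phi),\psi)$ given by $$(\mathrm{vE})(\Theta,\Gamma,\Lambda)=\big((\mathrm{vE})(\Theta),\ (\mathrm{vE})(\Gamma),\ (\mathrm{vE})(\Lambda)\big)$$ defines a homomorphism of cochain complexes from $\{C^*_{\mathsf{mLG},d}(\Phi,\psi),\delta_{\mathsf{mLG}}\}$ to $\{C^*_{\mathsf{mLA}}(\mathrm{Lie}(\Phi),\psi),\delta_{\mathsf{mLA}}\}$. Hence there is an induced map $\mathrm{vE}:H^*_{\mathsf{mLG},d}(\Phi,\psi)\to H^*_{\mathsf{mLA}}(\mathrm{Lie}(\Phi),\psi)$ on the level of cohomology.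
   Context: A morphism Lie group is a triple $(G,H,\Phi)$ of two Lie groups and a Lie group homomorphism $\Phi:G\to H$. Its infinitesimal is the morphism Lie algebra $(\mathrm{Lie}(G),\mathrm{Lie}(H),\mathrm{Lie}(\Phi))$, where $\mathrm{Lie}(\Phi)=T_{1_G}\Phi$ (a morphism Lie algebra is a pair of Lie algebras with a Lie algebra homomorphism between them). A module over $(G,H,\Phi)$ is a triple $(V,W,\psi)$ of vector spaces $V,W$ with Lie group homomorphisms $\varrho_V:G\to\mathrm{Aut}(V)$, $\varrho_W:H\to\mathrm{Aut}(W)$ and a linear map $\psi:V\to W$ with $\psi(\varrho_V(g)v)=\varrho_W(\Phi(g))\psi(v)$ for $g\in G$, $v\in V$. $W_\Phi$ denotes the $G$-module $W$ with action $g\mapsto\varrho_W(\Phi(g))$. $V$ becomes a representation of $\mathrm{Lie}(G)$ by $\rho_V(X)v=\frac{d}{dt}|_{t=0}\varrho_V(\exp(tX))v$, and similarly $W$ is a representation of $\mathrm{Lie}(H)$ (action $\rho_W$), so that $(V,W,\psi)$ is a representation of $(\mathrm{Lie}(G),\mathrm{Lie}(H),\mathrm{Lie}(\Phi))$. Group side. For a $G$-module $V$, $C^n_{\mathsf{gp}}(G,V)=\mathrm{Maps}(G^{\times n},V)$, $n\ge0$, with $$(\delta_{\mathsf{gp}}f)(g_1,\ldots,g_{n+1})=\varrho_V(g_1)f(g_2,\ldots,g_{n+1})+\sum_{i=1}^n(-1)^if(g_1,\ldots,g_i\cdot g_{i+1},\ldots,g_{n+1})+(-1)^{n+1}f(g_1,\ldots,g_n).$$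 The subcomplex $C^*_{\mathsf{gp},d}(G,V)$ is given by $C^n_{\mathsf{gp},d}(G,V)=\{f\in C^n_{\mathsf{gp}}(G,V)\mid f(g_1,\ldots,g_n)=0\text{ if some }g_i=1_G\}$. Let $\delta'_{\mathsf{gp}},\delta''_{\mathsf{gp}},\delta'''_{\mathsf{gp}}$ be the coboundaries for $G$ with coefficients in $V$, $H$ with coefficients in $W$, $G$ with coefficients in $W_\Phi$. Set $C^0_{\mathsf{mLG},d}(\Phi,\psi)=V$ and $C^n_{\mathsf{mLG},d}(\Phi,\psi)=C^n_{\mathsf{gp},d}(G,V)\oplus C^n_{\mathsf{gp},d}(H,W)\oplus C^{n-1}_{\mathsf{gp},d}(G,W_\Phi)$ for $n\ge1$, with $\delta_{\mathsf{mLG}}(v)=(\delta'_{\mathsf{gp}}(v),\delta''_{\mathsf{gp}}(\psi(v)),0)$ for $v\in V$ and $\delta_{\mathsf{mLG}}(\Theta,\Gamma,\Lambda)=(\delta'_{\mathsf{gp}}\Theta,\delta''_{\mathsf{gp}}\Gamma,\psi\circ\Theta-\Gamma\circ\Phi^{\times n}-\delta'''_{\mathsf{gp}}\Lambda)$ for $n\ge1$. Its cohomology $H^*_{\mathsf{mLG},d}(\Phi,\psi)$ is called the differentiable cohomology of $(G,H,\Phi)$ with coefficients in $(V,W,\psi)$. Lie algebra side. For a Lie algebra $\mathfrak{g}$ with representation $(V,\rho)$, $C^n_{\mathsf{CE}}(\mathfrak{g},V)=\mathrm{Hom}(\wedge^n\mathfrak{g},V)$ with $(\delta_{\mathsf{CE}}f)(x_1,\ldots,x_{n+1})=\sum_i(-1)^{i+1}\rho(x_i)f(\ldots,\widehat{x_i},\ldots)+\sum_{i<j}(-1)^{i+j}f([x_i,x_j],\ldots,\widehat{x_i},\ldots,\widehat{x_j},\ldots)$.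 Let $\mathfrak{g}=\mathrm{Lie}(G)$, $\mathfrak{h}=\mathrm{Lie}(H)$, $\phi=\mathrm{Lie}(\Phi)$, let $W_\phi$ be $W$ with $\mathfrak{g}$-action $x\mapsto\rho_W(\phi(x))$, and let $\delta'_{\mathsf{CE}},\delta''_{\mathsf{CE}},\delta'''_{\mathsf{CE}}$ be the differentials for $(\mathfrak{g},V)$, $(\mathfrak{h},W)$, $(\mathfrak{g},W_\phi)$. Set $C^0_{\mathsf{mLA}}(\phi,\psi)=V$, $C^n_{\mathsf{mLA}}(\phi,\psi)=C^n_{\mathsf{CE}}(\mathfrak{g},V)\oplus C^n_{\mathsf{CE}}(\mathfrak{h},W)\oplus C^{n-1}_{\mathsf{CE}}(\mathfrak{g},W_\phi)$ for $n\ge1$, with $\delta_{\mathsf{mLA}}(v)=(\delta'_{\mathsf{CE}}v,\delta''_{\mathsf{CE}}(\psi(v)),0)$ for $v\in V$ and $\delta_{\mathsf{mLA}}(\theta,\gamma,\eta)=(\delta'_{\mathsf{CE}}\theta,\delta''_{\mathsf{CE}}\gamma,\psi\circ\theta-\gamma\circ\wedge^n\phi-\delta'''_{\mathsf{CE}}\eta)$ for $n\ge1$. Its cohomology is $H^*_{\mathsf{mLA}}(\phi,\psi)$. The van Est map. For a $G$-module $V$, $\mathrm{vE}:C^n_{\mathsf{gp},d}(G,V)\to C^n_{\mathsf{CE}}(\mathrm{Lie}(G),V)$ is $$(\mathrm{vE})(f)(X_1,\ldots,X_n)=\sum_{\sigma\in S_n}\mathrm{sgn}(\sigma)\,R_{X_{\sigma(1)}}\cdots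 R_{X_{\sigma(n)}}(f),$$ where $R_X:C^n_{\mathsf{gp},d}(G,V)\to C^{n-1}_{\mathsf{gp},d}(G,V)$ is the map which differentiates $f(-,g_2,\ldots,g_n)$ at the point $1_G$ with respect to the right invariant vector field corresponding to $X$. For $n=0$ this formula reads $(\mathrm{vE})(v)=v$, and this is the map in degree $0$, where both complexes are $V$.
   Formalization: The product R_{X_σ(1)}⋯R_{X_σ(n)}(f) is carried out from left to right (R_{X_σ(1)} differentiates the first argument); with ordinary composition vE changes by (-1)^{n(n-1)/2} and fails to commute with the differentials in odd degrees. *)

(* Defs.v *)
From HB Require Import structures.
From mathcomp Require Import all_boot all_order perm all_algebra.
From mathcomp Require Import boolp classical_sets functions reals.
From mathcomp Require Import topology normedtype landau derive.
Set Implicit Arguments.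
Unset Strict Implicit.
Unset Printing Implicit Defensive.
Import Order.TTheory GRing.Theory Num.Theory.
Import numFieldNormedType.Exports VectorInternalTheory.
Local Open Scope classical_set_scope.
Local Open Scope quotient_scope.
Local Open Scope ring_scope.

(* The space of n-cochains is the subspace [cochains] of a larger space
   [ambient] (all functions, say) on which the formula for the differential
   makes sense.  Cohomology is the space of cocycles in [cochains] modulo those
   cocycles that are differentials of elements of [cochains].  This needs no
   proof that the differential squares to zero, hence no such field. *)
Record cochain_complex (R : realType) := CochainComplex {
  ambient : nat -> lmodType R;
  cochains : forall n, set (ambient n);
  differential : forall n, ambient n -> ambient n.+1;
  cochains0 : forall n, @cochains n 0;
  cochainsP : forall n (a : R) (x y : ambient n),
    cochains x -> cochains y -> cochains (a *: x + y);
  differential_linear : forall n, linear (@differential n) }.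

Section Cohomology.
Context {R : realType} (C : cochain_complex R) (n : nat).

Definition cocycles : {pred ambient C n} :=
  [pred x | `[< cochains x /\ differential x = 0 >]].

Lemma cocycles_submod : submod_closed cocycles.
Proof.
have d0 : @differential _ C n 0 = 0.
  by have := @differential_linear _ C n (-1) 0 0; rewrite scaler0 addr0 scaleN1r addNr.
split; first by apply/asboolP; split => //; exact: cochains0.
move=> a x y /asboolP[Cx dx] /asboolP[Cy dy]; apply/asboolP; split.
  exact: cochainsP.
by rewrite differential_linear dx dy scaler0 addr0.
Qed.
HB.instance Definition _ :=
  GRing.isSubmodClosed.Build R (ambient C n) cocycles cocycles_submod.

Record cocycle := Cocycle {
  cocycle_val :> ambient C n; _ : cocycle_val \in cocycles }.
HB.instance Definition _ := [isSub for cocycle_val].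
HB.instance Definition _ := [Choice of cocycle by <:].
HB.instance Definition _ := [SubChoice_isSubLmodule of cocycle by <:].
End Cohomology.

Section Coboundary.
Context {R : realType} (C : cochain_complex R).

Definition is_coboundary n : ambient C n -> Prop :=
  match n with
  | 0 => fun x => x = 0
  | m.+1 => fun x => exists2 b : ambient C m, cochains b & x = differential b
  end.

Definition coboundaries n : {pred cocycle C n} :=
  [pred z | `[< is_coboundary (val z) >]].
Arguments coboundaries n : clear implicits.

Lemma coboundaries_submod n : submod_closed (coboundaries n).
Proof.
split.
  apply/asboolP; case: n => //= n; exists 0; first exact: cochains0.
  by have := @differential_linear _ C n (-1) 0 0; rewrite scaler0 addr0 scaleN1r addNr.
case: n => [|n] a x y /asboolP bx /asboolP byy; apply/asboolP; rewrite linearP.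
  by move: bx byy => /= -> ->; rewrite scaler0 addr0.
move: bx byy => /= [b Cb ->] [c Cc ->]; exists (a *: b + c).
  exact: cochainsP.
by rewrite differential_linear.
Qed.
HB.instance Definition _ n :=
  GRing.isSubmodClosed.Build R (cocycle C n) (coboundaries n)
    (coboundaries_submod n).

Definition cohomology n : Type := {ideal_quot coboundaries n}.
HB.instance Definition _ n := GRing.Zmodule.on (cohomology n).

Definition coh_class n (z : cocycle C n) : cohomology n :=
  \pi_({ideal_quot coboundaries n}) z.

Lemma coh_classE n (z z' : cocycle C n) :
  (coh_class z == coh_class z') = (z - z' \in coboundaries n).
Proof. by rewrite Quotient.idealrBE. Qed.

Definition coh_scale n (a : R) (x : cohomology n) : cohomology n :=
  coh_class (a *: (repr (x : {ideal_quot coboundaries n}) : cocycle C n)).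

Lemma coh_classZ n a (z : cocycle C n) :
  coh_scale a (coh_class z) = coh_class (a *: z).
Proof.
apply/eqP; rewrite coh_classE -scalerBr rpredZ// -coh_classE.
by rewrite /coh_class reprK.
Qed.

Lemma coh_classD n (z z' : cocycle C n) :
  coh_class z + coh_class z' = coh_class (z + z').
Proof. by rewrite /coh_class raddfD. Qed.

Lemma coh_class_surj n (x : cohomology n) : exists z, x = coh_class z.
Proof.
by exists (repr (x : {ideal_quot coboundaries n})); rewrite /coh_class reprK.
Qed.

Fact coh_scaleA n a b (x : cohomology n) :
  coh_scale a (coh_scale b x) = coh_scale (a * b) x.
Proof. by have [z ->] := coh_class_surj x; rewrite !coh_classZ scalerA. Qed.
Fact coh_scale1 n : left_id 1 (@coh_scale n).
Proof.
by move=> x; have [z ->] := coh_class_surj x; rewrite !coh_classZ scale1r.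
Qed.
Fact coh_scaleDr n : right_distributive (@coh_scale n) +%R.
Proof.
move=> a x y; have [z ->] := coh_class_surj x.
have [t ->] := coh_class_surj y.
by rewrite coh_classD !coh_classZ coh_classD scalerDr.
Qed.
Fact coh_scaleDl n (x : cohomology n) : {morph (@coh_scale n)^~ x : a b / a + b}.
Proof.
move=> a b; have [z ->] := coh_class_surj x.
by rewrite !coh_classZ coh_classD scalerDl.
Qed.
HB.instance Definition _ n := GRing.Zmodule_isLmodule.Build R (cohomology n)
  (@coh_scaleA n) (@coh_scale1 n) (@coh_scaleDr n) (@coh_scaleDl n).
End Coboundary.

Definition cochain_map (R : realType) (C D : cochain_complex R)
    (F : forall n, ambient C n -> ambient D n) : Prop :=
  [/\ forall n x, cochains x -> cochains (F n x),
      forall n (a : R) x y, cochains x -> cochains y ->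
        F n (a *: x + y) = a *: F n x + F n y
    & forall n x, cochains x -> F n.+1 (differential x) = differential (F n x)].

Section Smooth.
Context {R : realType}.

Fixpoint class_C {E F : normedModType R} (k : nat) (D : set E) (f : E -> F) :
    Prop :=
  match k with
  | 0 => forall x, D x -> {for x, continuous f}
  | k'.+1 => (forall x, D x -> differentiable f x) /\
             (forall v, class_C k' D ('D_v f))
  end.

Definition class_Coo {E F : normedModType R} (D : set E) (f : E -> F) : Prop :=
  forall k, class_C k D f.

Record chart (d : nat) (M : topologicalType) := Chart {
  chart_dom : set M;
  chart_map : M -> 'rV[R]_d;
  chart_inv : 'rV[R]_d -> M;
  open_chart_dom : open chart_dom;
  open_chart_img : open (chart_map @` chart_dom);
  chart_mapK : forall x, chart_dom x -> chart_inv (chart_map x) = x;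
  chart_map_cont : forall x, chart_dom x -> {for x, continuous chart_map};
  chart_inv_cont : forall y, (chart_map @` chart_dom) y -> {for y, continuous chart_inv} }.

Definition chart_img d (M : topologicalType) (c : chart d M) : set 'rV[R]_d :=
  chart_map c @` chart_dom c.
End Smooth.
Arguments chart R d M : clear implicits.

HB.mixin Record isManifold (R : realType) (d : nat) M of Topological M := {
  atlas : set (chart R d M);
  atlas_cover : forall x : M, exists c, atlas c /\ chart_dom c x;
  atlas_compat : forall c c', atlas c -> atlas c' ->
    class_Coo (chart_map c @` (chart_dom c `&` chart_dom c')) (chart_map c' \o chart_inv c);
  manifold_hausdorff : hausdorff_space M;
  manifold_second_countable : @second_countable M }.

#[short(type="manifoldType")]
HB.structure Definition Manifold (R : realType) (d : nat) :=
  {M of isManifold R d M & Topological M}.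

Section SmoothMaps.
Context {R : realType}.

Definition smooth_on {E : normedModType R} {e} {N : manifoldType R e}
    (D : set E) (f : E -> N) : Prop :=
  forall c : chart R e N, atlas c ->
    open (D `&` f @^-1` chart_dom c) /\
    class_Coo (D `&` f @^-1` chart_dom c) (chart_map c \o f).

(* A family of charts c_1, ..., c_n is a chart of M^n with values in
   (R^d)^n = 'M_(n, d). *)
Definition chart_img_pow d (M : manifoldType R d) n (c : 'I_n -> chart R d M) :
    set 'M[R]_(n, d) :=
  [set y | forall i, chart_img (c i) (row i y)].

Definition chart_inv_pow d (M : manifoldType R d) n (c : 'I_n -> chart R d M)
    (y : 'M[R]_(n, d)) : 'I_n -> M :=
  fun i => chart_inv (c i) (row i y).

Definition smooth_map d e (M : manifoldType R d) (N : manifoldType R e) n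
    (f : ('I_n -> M) -> N) : Prop :=
  forall c : 'I_n -> chart R d M, (forall i, atlas (c i)) ->
    smooth_on (chart_img_pow c) (f \o chart_inv_pow c).

Definition smooth_vec d (M : manifoldType R d) (V : vectType R) n
    (f : ('I_n -> M) -> V) : Prop :=
  forall c : 'I_n -> chart R d M, (forall i, atlas (c i)) ->
    class_Coo (chart_img_pow c) (fun y => v2r (f (chart_inv_pow c y))).
End SmoothMaps.

HB.mixin Record isLieGroup (R : realType) (d : nat) G
    of Manifold R d G & Group G := {
  smooth_mulg : smooth_map (fun x : 'I_2 -> G => (x ord0 * x ord_max)%g);
  smooth_invg : smooth_map (fun x : 'I_1 -> G => (x ord0)^-1%g) }.

#[short(type="lieGroupType")]
HB.structure Definition LieGroup (R : realType) (d : nat) :=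
  {G of isLieGroup R d G & Manifold R d G & Group G}.

(* The tangent space of G at 1, read in the chart chart1 below. *)
Definition Lie (R : realType) (d : nat) (G : lieGroupType R d) :
  normedModType R := 'rV[R]_d.

Section LieAlgebra.
Context {R : realType} {d : nat} (G : lieGroupType R d).

Definition chart1 : chart R d G := projT1 (cid (atlas_cover (1%g : G))).

Definition coord1 : 'rV[R]_d := chart_map chart1 (1%g : G).

Definition tangent1 (E : normedModType R) (f : G -> E) (X : Lie G) : E :=
  'D_(X : 'rV[R]_d) (f \o chart_inv chart1) coord1.

(* The invariant vector fields with value X at 1, read in the chart chart1:
   the velocity at y of g |-> y * g, respectively g |-> g * y, along X. *)
Definition left_field (X : Lie G) (y : 'rV[R]_d) : 'rV[R]_d :=
  tangent1 (fun g => chart_map chart1 (chart_inv chart1 y * g)%g) X.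
Definition right_field (X : Lie G) (y : 'rV[R]_d) : 'rV[R]_d :=
  tangent1 (fun g => chart_map chart1 (g * chart_inv chart1 y)%g) X.

Definition field_bracket (xi eta : 'rV[R]_d -> 'rV[R]_d) (y : 'rV[R]_d) :
    'rV[R]_d :=
  'D_(xi y) eta y - 'D_(eta y) xi y.

Definition Lie_bracket (X Y : Lie G) : Lie G :=
  field_bracket (left_field X) (left_field Y) coord1.

(* t |-> exp (t X) is the one-parameter subgroup with velocity X at 0; this
   determines exp. *)
Record exponential := Exponential {
  exp_fun :> Lie G -> G;
  expD : forall X (s t : R),
    exp_fun ((s + t) *: X) = (exp_fun (s *: X) * exp_fun (t *: X))%g;
  exp_smooth : forall X, smooth_on setT (fun t : R^o => exp_fun (t *: X));
  exp_velocity : forall X,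
    derive1 (fun t : R => chart_map chart1 (exp_fun (t *: X))) 0 = X }.

Record lie_rep (V : vectType R) := LieRep {
  rep_fun :> G -> 'End(V);
  rep1 : rep_fun 1%g = \1%VF;
  repM : forall g h, rep_fun (g * h)%g = (rep_fun g \o rep_fun h)%VF;
  rep_smooth : smooth_vec (fun x : 'I_1 -> G => rep_fun (x ord0)) }.

Definition rep_act (V : vectType R) (r : lie_rep V) (g : G) (v : V) : V :=
  r g v.

Definition inf_action (V : vectType R) (e : exponential) (r : lie_rep V)
    (X : Lie G) (v : V) : V :=
  r2v (derive1 (fun t : R => v2r (rep_act r (e (t *: X)) v)) 0).
End LieAlgebra.

Section LieMorphism.
Context {R : realType} {d e : nat}.

Record lie_hom (G : lieGroupType R d) (H : lieGroupType R e) := LieHom {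
  hom_fun :> G -> H;
  homM : {morph hom_fun : x y / (x * y)%g};
  hom_smooth : smooth_map (fun x : 'I_1 -> G => hom_fun (x ord0)) }.

Definition Lie_map (G : lieGroupType R d) (H : lieGroupType R e)
    (Phi : lie_hom G H) (X : Lie G) : Lie H :=
  tangent1 (fun g => chart_map (chart1 H) (Phi g)) X.
End LieMorphism.

Definition cons_arg T n (t : T) (x : 'I_n -> T) : 'I_n.+1 -> T :=
  fun i => oapp x t (unlift ord0 i).

Section GroupCochains.
Context {R : realType}.

Section Differential.
Context {G : groupType} {V : lmodType R} (act : G -> V -> V).

(* For i < n, the arguments (g_0, ..., g_i * g_(i+1), ..., g_n). *)
Definition merge_arg n (i : 'I_n) (g : 'I_n.+1 -> G) : 'I_n -> G :=
  fun j => if (j < i)%N then g (lift ord_max j)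
           else if j == i then (g (lift ord_max j) * g (lift ord0 j))%g
           else g (lift ord0 j).

Definition gp_diff n (f : ('I_n -> G) -> V) : ('I_n.+1 -> G) -> V :=
  fun g => act (g ord0) (f (g \o lift ord0))
    + \sum_(i < n) (-1) ^+ i.+1 *: f (merge_arg i g)
    + (-1) ^+ n.+1 *: f (g \o lift ord_max).
End Differential.

Context {d : nat} {G : lieGroupType R d} {V : vectType R}.

Definition gp_cochains n : set (('I_n -> G) -> V) :=
  [set f | smooth_vec f /\
           forall g : 'I_n -> G, (exists i, g i = 1%g) -> f g = 0].

Definition R_op n (X : Lie G) (f : ('I_n.+1 -> G) -> V) : ('I_n -> G) -> V :=
  fun g => r2v (tangent1 (fun h => v2r (f (cons_arg h g)))
                  (right_field X (coord1 G))).

(* R_{X_0} differentiates in the first argument, R_{X_1} in the second, and so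
   on: the product R_{X_0} ... R_{X_(n-1)} is carried out from left to right.
   In the other order the maps vE satisfy vE \o delta = (-1)^n delta \o vE in
   degree n, and are not compatible with the differentials. *)
Fixpoint R_prod n : ('I_n -> Lie G) -> (('I_n -> G) -> V) -> V :=
  match n with
  | 0 => fun _ f => f (fun=> 1%g)
  | m.+1 => fun X f => R_prod (X \o lift ord0) (R_op (X ord0) f)
  end.

Definition vanEst n (f : ('I_n -> G) -> V) : ('I_n -> Lie G) -> V :=
  fun X => \sum_(s : 'S_n) (-1) ^+ s *: R_prod (X \o s) f.
End GroupCochains.

Section LieCochains.
Context {R : realType} {L V : lmodType R}.

Definition multilinear n (f : ('I_n -> L) -> V) : Prop :=
  forall i (x : 'I_n -> L) (a : R) (u v : L),
    f [eta x with i |-> a *: u + v] =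
    a *: f [eta x with i |-> u] + f [eta x with i |-> v].

Definition alternating n (f : ('I_n -> L) -> V) : Prop :=
  forall (x : 'I_n -> L) i j, i != j -> x i = x j -> f x = 0.

Definition CE_cochains n : set (('I_n -> L) -> V) :=
  [set f | multilinear f /\ alternating f].

Context (bracket : L -> L -> L) (act : L -> V -> V).

(* For i < j, lift j i is the index with value i, so that the last sum ranges
   over all pairs i < j and its arguments are [x_i, x_j] followed by the
   entries of x other than x_i and x_j. *)
Definition CE_diff n : (('I_n -> L) -> V) -> ('I_n.+1 -> L) -> V :=
  match n with
  | 0 => fun f x => act (x ord0) (f (x \o lift ord0))
  | m.+1 => fun f x =>
      \sum_(i < m.+2) (-1) ^+ i *: act (x i) (f (x \o lift i))
      + \sum_(j < m.+2) \sum_(i < m.+1 | (i < j)%N)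
          (-1) ^+ (i + j) *:
            f (cons_arg (bracket (x (lift j i)) (x j)) (x \o lift j \o lift i))
  end.
End LieCochains.

Section SmoothTheory.
Context {R : realType}.

Lemma near_eq_differentiable (E F : normedModType R) (f g : E -> F) x :
  {near x, f =1 g} -> differentiable f x -> differentiable g x.
Proof.
move=> fg df; pose k := g - f.
have kx : k x = 0.
  by rewrite /k !fctE -(nbhs_singleton fg) subrr.
have -> : g = k + f by rewrite /k subrK.
apply: differentiableD => //.
have e : k \o shift x = cst (k x) + (\0 : {linear E -> F}) +o_0 id.
  rewrite kx; apply/eqaddoP => e e0.
  have : \forall y \near x, k y = 0.
    by apply: filterS fg => y fgy; rewrite /k !fctE -fgy subrr.
  rewrite (near_shift 0 x) subr0; apply: filterS => h /= kh.
  by rewrite !fctE /= kh addr0 subr0 normr0 mulr_ge0// ltW.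
have cc : continuous (\0 : {linear E -> F}) by move=> y; exact: cst_continuous.
have d0 := diff_unique cc e.
by apply/diff_locallyP; rewrite d0.
Qed.

Lemma class_C_lin (E F : normedModType R) k (D : set E) (a : R) (f g h : E -> F) :
  open D -> class_C k D f -> class_C k D g ->
  (forall x, D x -> h x = a *: f x + g x) -> class_C k D h.
Proof.
move=> oD; elim: k f g h => [|k IH] f g h /=.
  move=> Cf Cg hE x Dx.
  have nE : {near x, a \*: f + g =1 h}.
    near=> y; rewrite hE//; near: y; exact: open_nbhs_nbhs.
  rewrite /prop_for /continuous_at hE//.
  apply: (cvg_trans (@near_eq_cvg _ _ (nbhs x) _ _ _ nE)).
  by apply: cvgD; [apply: cvgZr|]; [exact: Cf|exact: Cg].
move=> [df Cf] [dg Cg] hE.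
have nE x : D x -> {near x, a \*: f + g =1 h}.
  by move=> Dx; near=> y; rewrite hE//; near: y; exact: open_nbhs_nbhs.
split=> [x Dx|v].
  apply: near_eq_differentiable (nE _ Dx) _.
  by apply: differentiableD; [apply: differentiableZ; exact: df|exact: dg].
apply: (IH _ _ _ (Cf v) (Cg v)) => x Dx.
rewrite -(near_eq_derive _ (nE _ Dx)) deriveD ?deriveZ//.
- exact/diff_derivable/df.
- by apply/derivableZ/diff_derivable/df.
- exact/diff_derivable/dg.
Unshelve. all: by end_near. Qed.

Lemma class_C_cst (E F : normedModType R) k (D : set E) (a : F) :
  class_C k D (fun _ : E => a).
Proof.
elim: k a => [|k IH] a /=; first by move=> x _; exact: cst_continuous.
split=> [x _|v]; first exact: differentiable_cst.
rewrite (_ : 'D_v _ = fun=> 0); first exact: IH.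
by apply/funext => x; rewrite derive_cst.
Qed.

Lemma linear_mx_differentiable m n (F : normedModType R)
    (L : {linear 'M[R]_(m, n) -> F}) x : differentiable L x.
Proof.
have -> : (L : _ -> _) =
    \sum_(i < m) \sum_(j < n) fun y : 'M[R]_(m, n) => y i j *: L (delta_mx i j).
  apply/funext => y; rewrite {1}(matrix_sum_delta y) linear_sum fct_sumE.
  apply: eq_bigr => i _; rewrite linear_sum fct_sumE.
  by apply: eq_bigr => j _; rewrite linearZ.
apply: differentiable_sum => i; apply: differentiable_sum => j.
by apply: differentiableZl; exact: differentiable_coord.
Qed.

Lemma open_chart_img_pow d (M : manifoldType R d) n (c : 'I_n -> chart R d M) :
  open (chart_img_pow c).
Proof.
rewrite openE => y yc.
have := @filter_forall _ _ (fun i y => chart_img (c i) (row i y)) (nbhs y) _.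
apply => i.
have : {for y, continuous (@row R n d i)}.
  apply: differentiable_continuous.
  exact: (@linear_mx_differentiable _ _ 'rV[R]_d (@row R n d i)).
by apply; apply: open_nbhs_nbhs; split; [exact: open_chart_img|exact: yc].
Qed.
End SmoothTheory.

Section Subspaces.
Context {R : realType}.

Lemma gp_cochains0 d (G : lieGroupType R d) (V : vectType R) n :
  gp_cochains (0 : ('I_n -> G) -> V).
Proof.
split=> // c _ k; rewrite (_ : (fun _ => _) = cst 0); first exact: class_C_cst.
by apply/funext => y; rewrite linear0.
Qed.

Lemma gp_cochainsP d (G : lieGroupType R d) (V : vectType R) n (a : R)
    (f g : ('I_n -> G) -> V) :
  gp_cochains f -> gp_cochains g -> gp_cochains (a *: f + g).
Proof.
move=> [sf f0] [sg g0]; split=> [c ca k|x x1]; last first.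
  by rewrite !fctE f0// g0// scaler0 addr0.
apply: (class_C_lin (a := a) _ (sf c ca k) (sg c ca k)) => [|y _].
  exact: open_chart_img_pow.
by rewrite !fctE linearP.
Qed.

Lemma CE_cochains0 (L V : lmodType R) n : CE_cochains (0 : ('I_n -> L) -> V).
Proof.
split=> // i x a u v; change (0 = a *: (0 : V) + 0).
by rewrite scaler0 addr0.
Qed.

Lemma CE_cochainsP (L V : lmodType R) n (a : R) (f g : ('I_n -> L) -> V) :
  CE_cochains f -> CE_cochains g -> CE_cochains (a *: f + g).
Proof.
move=> [mf af] [mg ag]; split=> [i x b u v|x i j ij xij]; last first.
  by rewrite !fctE (af _ _ _ ij)// (ag _ _ _ ij)// scaler0 addr0.
by rewrite !fctE mf mg !scalerDr !scalerA [a * b]mulrC addrACA.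
Qed.

Lemma gp_diff_linear (G : groupType) (V : lmodType R) (act : G -> V -> V) n :
  (forall g, linear (act g)) -> linear (@gp_diff R G V act n).
Proof.
move=> la a f g; apply/funext => x; rewrite /gp_diff !fctE la !scalerDr.
rewrite (eq_bigr (fun i : 'I_n => a *: ((-1) ^+ i.+1 *: f (merge_arg i x))
   + (-1) ^+ i.+1 *: g (merge_arg i x))); last first.
  by move=> i _; rewrite scalerDr !scalerA mulrC.
rewrite big_split/= -scaler_sumr !scalerA [_ * a]mulrC.
by rewrite [RHS]addrACA [X in _ = X + _]addrACA.
Qed.

Lemma CE_diff_linear (L V : lmodType R) (b : L -> L -> L) (act : L -> V -> V) n :
  (forall x, linear (act x)) -> linear (CE_diff b act (n := n)).
Proof.
move=> la a f g; apply/funext => x; case: n f g x => [|n] f g x /=.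
  by rewrite !fctE la.
rewrite !fctE scalerDr addrACA; congr (_ + _).
  rewrite scaler_sumr -big_split/=; apply: eq_bigr => i _.
  by rewrite la scalerDr !scalerA mulrC.
rewrite scaler_sumr -big_split/=; apply: eq_bigr => j _.
rewrite scaler_sumr -big_split/=; apply: eq_bigr => i _.
by rewrite scalerDr !scalerA mulrC.
Qed.

Lemma lin3 (V : lmodType R) (a : R) (p p' q q' r r' : V) :
  a *: p + p' - (a *: q + q') - (a *: r + r') =
  a *: (p - q - r) + (p' - q' - r').
Proof.
by rewrite !scalerBr !opprD [X in X + _ = _]addrACA [LHS]addrACA.
Qed.

Lemma rep_act_linear d (G : lieGroupType R d) (V : vectType R) (r : lie_rep G V) g :
  linear (rep_act r g).
Proof. by move=> a u v; rewrite /rep_act linearP. Qed.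

Lemma exponential0 d (G : lieGroupType R d) (e : exponential G) : e 0 = 1%g.
Proof.
have := expD e 0 0 0; rewrite addr0 !scale0r => /esym h.
by apply: (@mulgI G (e 0)); rewrite h mulg1.
Qed.

Lemma inf_action_linear d (G : lieGroupType R d) (V : vectType R)
    (e : exponential G) (r : lie_rep G V) X : linear (inf_action e r X).
Proof.
have dr : differentiable (fun t : R => v2r (r (e (t *: X)))) 0.
  have [atl dom1] := projT2 (cid (atlas_cover (1%g : G))).
  have [oD sD] := exp_smooth e X atl.
  have D0 : ([set: R^o] `&` (fun t : R^o => e (t *: X)) @^-1`
      chart_dom (projT1 (cid (atlas_cover (1%g : G))))) 0.
    by split => //=; rewrite scale0r exponential0.
  have [/(_ 0 D0) dc _] := sD 1%N.
  have [/(_ (coord1 G)) dro _] := rep_smooth r (fun=> atl) 1%N.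
  pose f2 := fun y : 'rV[R]_d => v2r (r (chart_inv (chart1 G) y)).
  have df2 : differentiable f2 (coord1 G).
    rewrite (_ : f2 = fun y => v2r (r (chart_inv_pow (fun=> chart1 G) y ord0))).
      apply: dro => i; rewrite row_id /chart_img.
      by exists (1%g : G).
    by apply/funext => y; rewrite /f2 /chart_inv_pow row_id.
  apply: (near_eq_differentiable
    (f := f2 \o (chart_map (chart1 G) \o fun t : R^o => e (t *: X)))).
    have : nbhs (0 : R^o) _ := open_nbhs_nbhs (conj oD D0).
    apply: filterS => t [_ /= Dt].
    by rewrite /f2/= chart_mapK.
  apply: differentiable_comp => //=.
  by rewrite scale0r exponential0.
pose F u := fun t : R => v2r (rep_act r (e (t *: X)) u).
have du u : derivable (F u) 0 1.
  pose L := fun z => v2r ((r2v z : 'End(V)) u).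
  have linL : linear L.
    by move=> a y z; rewrite /L linearP /= add_lfunE scale_lfunE linearP.
  pose L' : {linear _ -> _} := HB.pack L (GRing.isLinear.Build R _ _ _ L linL).
  apply/derivable1_diffP.
  rewrite (_ : F u = L' \o (fun t : R => v2r (r (e (t *: X))))).
    by apply: differentiable_comp => //; exact: linear_mx_differentiable.
  by apply/funext => t; rewrite /= /L v2rK.
move=> a u v; have FE : F (a *: u + v) = a \*: F u + F v.
  by apply/funext => t; rewrite /F rep_act_linear linearP.
have DE : derive1 (F (a *: u + v)) 0 = a *: derive1 (F u) 0 + derive1 (F v) 0.
  rewrite !derive1E FE.
  rewrite (deriveD (derivableZ (du u)) (du v)).
  by rewrite (deriveZ a (du u)).
by rewrite /inf_action -/(F _) DE linearP.
Qed.
End Subspaces.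

Section MorphismLieGroup.
Context {R : realType} {d e : nat} {G : lieGroupType R d} {H : lieGroupType R e}.
Context (Phi : lie_hom G H) {V W : vectType R}.
Context (rV : lie_rep G V) (rW : lie_rep H W) (psi : 'Hom(V, W)).

Definition mLG_ambient (n : nat) : lmodType R :=
  match n with
  | 0 => V
  | m.+1 => ((('I_m.+1 -> G) -> V) * (('I_m.+1 -> H) -> W)
             * (('I_m -> G) -> W))%type
  end.

Definition mLG_cochains n : set (mLG_ambient n) :=
  match n return set (mLG_ambient n) with
  | 0 => setT
  | m.+1 => [set c | [/\ gp_cochains c.1.1, gp_cochains c.1.2
                       & gp_cochains c.2]]
  end.

Definition mLG_diff n : mLG_ambient n -> mLG_ambient n.+1 :=
  match n return mLG_ambient n -> mLG_ambient n.+1 with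
  | 0 => fun v => (gp_diff (rep_act rV) (fun _ : 'I_0 -> G => v),
                   gp_diff (rep_act rW) (fun _ : 'I_0 -> H => psi v), 0)
  | m.+1 => fun c =>
      let: (Theta, Gamma, Lambda) := c in
      (gp_diff (rep_act rV) Theta, gp_diff (rep_act rW) Gamma,
       fun g => psi (Theta g) - Gamma (Phi \o g)
                - gp_diff (rep_act rW \o Phi) Lambda g)
  end.

Fact mLG_cochains0 n : @mLG_cochains n 0.
Proof. by case: n => // n; split; exact: gp_cochains0. Qed.

Fact mLG_cochainsP n (a : R) (x y : mLG_ambient n) :
  mLG_cochains x -> mLG_cochains y -> mLG_cochains (a *: x + y).
Proof.
by case: n x y => // n x y [? ? ?] [? ? ?]; split; exact: gp_cochainsP.
Qed.

Fact mLG_diff_linear n : linear (@mLG_diff n).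
Proof.
have lV := rep_act_linear rV; have lW := rep_act_linear rW.
case: n => [|n] a.
  move=> u v; congr (_, _, _).
  - rewrite -gp_diff_linear//.
  - by rewrite -gp_diff_linear// linearP.
  - by apply/funext => z; rewrite !fctE /= scaler0 addr0.
move=> [[x1 x2] x3] [[y1 y2] y3]; congr (_, _, _); try exact: gp_diff_linear.
have l3 g : linear ((rep_act rW \o Phi) g) by exact: lW.
apply/funext => g; rewrite (@gp_diff_linear R G W _ n l3) !fctE linearP.
exact: lin3.
Qed.

Definition mLG_complex : cochain_complex R :=
  CochainComplex mLG_cochains0 mLG_cochainsP mLG_diff_linear.
End MorphismLieGroup.

Section MorphismLieAlgebra.
Context {R : realType} {g h : lmodType R} (bg : g -> g -> g) (bh : h -> h -> h).
Context (phi : g -> h) {V W : lmodType R}.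
Context (aV : g -> V -> V) (aW : h -> W -> W) (psi : {linear V -> W}).

Definition mLA_ambient (n : nat) : lmodType R :=
  match n with
  | 0 => V
  | m.+1 => ((('I_m.+1 -> g) -> V) * (('I_m.+1 -> h) -> W)
             * (('I_m -> g) -> W))%type
  end.

Definition mLA_cochains n : set (mLA_ambient n) :=
  match n return set (mLA_ambient n) with
  | 0 => setT
  | m.+1 => [set c | [/\ CE_cochains c.1.1, CE_cochains c.1.2
                       & CE_cochains c.2]]
  end.

Definition mLA_diff n : mLA_ambient n -> mLA_ambient n.+1 :=
  match n return mLA_ambient n -> mLA_ambient n.+1 with
  | 0 => fun v => (CE_diff bg aV (fun _ : 'I_0 -> g => v),
                   CE_diff bh aW (fun _ : 'I_0 -> h => psi v), 0)
  | m.+1 => fun c =>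
      let: (theta, gamma, eta) := c in
      (CE_diff bg aV theta, CE_diff bh aW gamma,
       fun x => psi (theta x) - gamma (phi \o x)
                - CE_diff bg (aW \o phi) eta x)
  end.

Fact mLA_cochains0 n : @mLA_cochains n 0.
Proof. by case: n => // n; split; exact: CE_cochains0. Qed.

Fact mLA_cochainsP n (a : R) (x y : mLA_ambient n) :
  mLA_cochains x -> mLA_cochains y -> mLA_cochains (a *: x + y).
Proof.
by case: n x y => // n x y [? ? ?] [? ? ?]; split; exact: CE_cochainsP.
Qed.

Hypotheses (lV : forall x, linear (aV x)) (lW : forall x, linear (aW x)).

Fact mLA_diff_linear n : linear (@mLA_diff n).
Proof.
case: n => [|n] a.
  move=> u v; congr (_, _, _).
  - by rewrite -CE_diff_linear.
  - by rewrite -CE_diff_linear// linearP.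
  - by apply/funext => z; rewrite !fctE /= scaler0 addr0.
move=> [[x1 x2] x3] [[y1 y2] y3]; congr (_, _, _); try exact: CE_diff_linear.
have l3 x : linear ((aW \o phi) x) by exact: lW.
apply/funext => x; rewrite (@CE_diff_linear R g W bg _ n l3) !fctE linearP.
exact: lin3.
Qed.

Definition mLA_complex : cochain_complex R :=
  CochainComplex mLA_cochains0 mLA_cochainsP mLA_diff_linear.
End MorphismLieAlgebra.

Definition mvE (R : realType) d e (G : lieGroupType R d) (H : lieGroupType R e)
    (V W : vectType R) n :
    @mLG_ambient R d e G H V W n -> @mLA_ambient R (Lie G) (Lie H) V W n :=
  match n return @mLG_ambient R d e G H V W n ->
                 @mLA_ambient R (Lie G) (Lie H) V W n with
  | 0 => id
  | m.+1 => fun c => (vanEst c.1.1, vanEst c.1.2, vanEst c.2)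
  end.

(* Main.v *)
Require Import Defs.
From HB Require Import structures.
From mathcomp Require Import all_boot all_order perm all_algebra zify.
From mathcomp Require Import boolp classical_sets functions reals.
From mathcomp Require Import topology normedtype landau derive.
Set Implicit Arguments.
Unset Strict Implicit.
Unset Printing Implicit Defensive.
Import Order.TTheory GRing.Theory Num.Theory numFieldNormedType.Exports.
Import VectorInternalTheory.
Local Open Scope classical_set_scope.
Local Open Scope ring_scope.

(* Read in the chart at 1, the van Est map is an antisymmetrized iterated partial
   derivative at the identity, the i-th derivative acting on the i-th argument.
   On the terms of the group differential it acts as follows. The first term
   gives the infinitesimal action; the last one does not depend on the last
   argument and is killed. For the term merging the arguments i and i + 1, the
   permutation sum is grouped in pairs s, (i i+1) s: since
   D_Y D_X f(gh) = D_Y D_X f + D_(B(X,Y)) f, with B the second derivative of the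
   multiplication, and since second derivatives are symmetric, each pair
   contributes the derivative of f along B(X,Y) - B(Y,X) = [X,Y] in slot i.
   Parametrizing the remaining permutations by the images a, b of i and i + 1
   yields the Chevalley-Eilenberg sum. Pullback along the homomorphism and
   composition with psi commute with the iterated derivatives by the chain rule
   and by linearity. *)

(** * Calculus *)

Section Calculus.
Context {R : realType}.

Section AffinePrecomposition.
Context {E' E F : normedModType R} (A L : E' -> E).
Hypothesis AL : forall (h : R) v y, A (h *: v + y) = h *: L v + A y.

(** The difference quotient of [f \o A] at y along v is literally that of f at [A y] along [L v], so
    the identity holds whether or not the limit exists. *)
Lemma derive_affine (f : E -> F) v : 'D_v (f \o A) = 'D_(L v) f \o A.
Proof.
by apply/funext => y; rewrite /derive /=; under eq_fun do rewrite AL.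
Qed.

Lemma derive_affine_at (f : E -> F) v y : 'D_v (f \o A) y = 'D_(L v) f (A y).
Proof. by have /(congr1 (@^~ y)) := derive_affine f v. Qed.

Lemma derivable_affine (f : E -> F) v y :
  derivable f (A y) (L v) -> derivable (f \o A) y v.
Proof.
rewrite /derivable /= (_ : (fun h => _) = (fun h => h^-1 *: (f (A (h *: v + y)) - f (A y))))//.
by apply/funext => h; rewrite AL.
Qed.

Lemma class_C_affine k (D : set E) (D' : set E') (f : E -> F) :
  (forall y, differentiable A y) -> (forall y, D' y -> D (A y)) ->
  class_C k D f -> class_C k D' (f \o A).
Proof.
move=> dA DA; elim: k f => [|k IH] f /=.
  move=> cf y D'y; apply: continuous_comp; last exact/cf/DA.
  exact: differentiable_continuous.
move=> [df Cf]; split=> [y D'y|v].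
  by apply: differentiable_comp => //; exact/df/DA.
by rewrite derive_affine; exact/IH/Cf.
Qed.
End AffinePrecomposition.

Lemma class_Coo_derive (E F : normedModType R) (D : set E) (f : E -> F) v :
  class_Coo D f -> class_Coo D ('D_v f).
Proof. by move=> Cf k; have [_] := Cf k.+1; apply. Qed.

Lemma class_Coo_differentiable (E F : normedModType R) (D : set E) (f : E -> F) x :
  class_Coo D f -> D x -> differentiable f x.
Proof. by move=> Cf; have [+ _] := Cf 1; apply. Qed.

Lemma derive_comp (E' E F : normedModType R) (g : E' -> E) (f : E -> F) x v :
  differentiable g x -> differentiable f (g x) ->
  'D_v (f \o g) x = 'D_('D_v g x) f (g x).
Proof.
move=> dg df; rewrite !deriveE//; last exact: differentiable_comp.
by rewrite diff_comp.
Qed.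

Lemma derive_linear_dir (E F : normedModType R) (f : E -> F) x a u v :
  differentiable f x -> 'D_(a *: u + v) f x = a *: 'D_u f x + 'D_v f x.
Proof. by move=> df; rewrite !deriveE// linearP. Qed.

Lemma is_derive_scale (E F : normedModType R) (k : E -> R) (f : E -> F) x v dk df :
  is_derive x v k dk -> is_derive x v f df ->
  is_derive x v (fun y => k y *: f y) (k x *: df + dk *: f x).
Proof.
move=> [k1 <-] [f1 <-]; suff H : (h^-1 *: (k (h *: v + x) *: f (h *: v + x) - k x *: f x))
    @[h --> 0^'] --> k x *: 'D_v f x + 'D_v k x *: f x.
  by split; [apply/cvg_ex; eexists; exact: H|exact: cvg_lim H].
have E1 : (fun h : R => h^-1 *: (k (h *: v + x) *: f (h *: v + x) - k x *: f x)) =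
   (fun h : R => k (h *: v + x) *: (h^-1 *: (f (h *: v + x) - f x))
      + (h^-1 *: (k (h *: v + x) - k x)) *: f x).
  have aux (h a b : R) (p q : F) :
      h *: (a *: p - b *: q) = a *: (h *: (p - q)) + (h * (a - b)) *: q.
    rewrite scalerA [a * h]mulrC -!scalerA -scalerDr; congr (_ *: _).
    by rewrite scalerBr scalerBl addrA subrK.
  by apply/funext => h; exact: aux.
rewrite E1; apply: cvgD; last by apply: cvgZr_tmp; exact: k1.
apply: cvgZ; last exact: f1.
(* k is known to be derivable along v only; this gives continuity on the line through x, which is
   where the difference quotient lives. *)
have kc : {for 0, continuous (fun h : R => k (h *: v + x))}.
  by apply/differentiable_continuous/derivable1_diffP; move/derivable1P: k1.
by move/continuous_withinNx : kc; rewrite scale0r add0r.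
Qed.

Lemma is_derive_linear (E F : normedModType R) m n (L : {linear 'M[R]_(m, n) -> F})
    (f : E -> 'M[R]_(m, n)) x v df :
  is_derive x v f df -> is_derive x v (L \o f) (L df).
Proof.
move=> [f1 <-]; suff H : (h^-1 *: (L (f (h *: v + x)) - L (f x)))
    @[h --> 0^'] --> L ('D_v f x).
  by split; [apply/cvg_ex; eexists; exact: H|exact: cvg_lim H].
under eq_fun do rewrite -linearB -linearZ.
apply: continuous_cvg; last exact: f1.
exact/differentiable_continuous/linear_mx_differentiable.
Qed.

Lemma class_C_linear (E F : normedModType R) m n (L : {linear 'M[R]_(m, n) -> F}) k
    (D : set E) (f : E -> 'M[R]_(m, n)) :
  open D -> class_C k D f -> class_C k D (L \o f).
Proof.
move=> oD; elim: k f => [|k IH] f /=.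
  move=> cf y Dy; apply: continuous_comp; first exact: cf.
  exact/differentiable_continuous/linear_mx_differentiable.
move=> [df Cf]; split=> [y Dy|v].
  apply: differentiable_comp; first exact: df.
  exact: linear_mx_differentiable.
(* The derivative of [L \o f] is [L \o 'D_v f] on D only. Adding the zero function in [class_C_lin]
   serves to replace a function by one that agrees with it on the open set D. *)
apply: (class_C_lin (a := 1) oD (IH _ (Cf v)) (class_C_cst k D 0)) => y Dy.
have /derivableP dfy : derivable f y v by exact/diff_derivable/df.
by rewrite scale1r addr0 (@derive_val _ _ _ _ _ _ _ (is_derive_linear L dfy)).
Qed.

Lemma affine_differentiable (E : normedModType R) m n (A L : 'M[R]_(m, n) -> E) :
  (forall (h : R) v y, A (h *: v + y) = h *: L v + A y) ->
  forall y, differentiable A y.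
Proof.
move=> AL; have LE v : L v = A v - A 0.
  by have := AL 1 v 0; rewrite !scale1r addr0 => ->; rewrite addrK.
have linL : linear L.
  by move=> a u v; rewrite !LE AL LE addrA.
pose L' : {linear _ -> _} := HB.pack L (GRing.isLinear.Build R _ _ _ L linL).
move=> y; rewrite (_ : A = (L' : _ -> _) + cst (A 0)).
  apply: differentiableD; last exact: differentiable_cst.
  exact: linear_mx_differentiable.
by apply/funext => z; rewrite fctE /= LE subrK.
Qed.

Lemma near_two_continuous (E : normedModType R) (D : set E) (f g : E -> R) x e :
  open D -> D x -> {for x, continuous f} -> {for x, continuous g} -> 0 < e ->
  exists2 r : R, 0 < r & forall y, ball x r y ->
    [/\ D y, `|f x - f y| <= e & `|g x - g y| <= e].
Proof.
move=> oD Dx cf cg e0.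
have : \forall y \near x, [/\ D y, `|f x - f y| <= e & `|g x - g y| <= e].
  near=> y; split; near: y; first exact: open_nbhs_nbhs.
    by move/cvgrPdist_le : cf; apply.
  by move/cvgrPdist_le : cg; apply.
by move/nbhs_ballP => [r /= r0 rP]; exists r.
Unshelve. all: by end_near. Qed.

(** * Symmetry of second derivatives *)

Section Schwarz.
Context {E : normedModType R} (D : set E) (f : E -> R).

Lemma is_derive_line (F : normedModType R) (g : E -> F) u y (a : R) :
  differentiable g (a *: u + y) ->
  is_derive a 1 (fun b : R => g (b *: u + y)) ('D_u g (a *: u + y)).
Proof.
move=> dg; pose A b : E := b *: u + y.
have AL (h b c : R) : A (h *: b + c) = h *: (b *: u) + A c.
  by rewrite /A scalerDl -scalerA addrA.
split; last by have := derive_affine_at AL g 1 a; rewrite scale1r.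
by apply: (derivable_affine AL (f := g)); rewrite scale1r; apply: diff_derivable.
Qed.

(** The mean value theorem is applied twice: along u to the increment g of f in the direction
    [d *: v], then along v to ['D_u f] at the intermediate parameter s. *)
Lemma second_difference x u v (d : R) : 0 < d -> class_C 2 D f ->
  (forall s t, 0 <= s <= d -> 0 <= t <= d -> D (s *: u + (t *: v + x))) ->
  exists s t, [/\ 0 <= s <= d, 0 <= t <= d &
    f (d *: u + (d *: v + x)) - f (d *: u + x) - (f (d *: v + x) - f x) =
    'D_v ('D_u f) (s *: u + (t *: v + x)) * d * d].
Proof.
move=> d0 [df ddf] HD.
have dd0 : 0 <= d <= d by rewrite ltW/=.
have z0 : 0 <= (0 : R) <= d by rewrite lexx ltW.
have i2c (s : R) : s \in `]0, d[%R -> 0 <= s <= d.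
  by rewrite in_itv/= => /andP[s0 sd]; rewrite !ltW.
pose g a := f (a *: u + (d *: v + x)) - f (a *: u + x).
have dg (a : R) : 0 <= a <= d -> is_derive a 1 g
   ('D_u f (a *: u + (d *: v + x)) - 'D_u f (a *: u + x)).
  move=> ad; apply: is_deriveB; apply: is_derive_line; apply: df; first exact: HD.
  by have := HD a 0 ad z0; rewrite scale0r add0r.
have [s sd] := MVT d0 (fun a ai => dg a (i2c _ ai)) (derivable_within_continuous
   (fun a (ai : a \in `[0, d]%R) => @ex_derive _ _ _ _ _ _ _
     (dg a ltac:(by move: ai; rewrite in_itv)))).
rewrite subr0 /g scale0r !add0r => ->.
have ss := i2c _ sd.
pose k (b : R) := 'D_u f (b *: v + (s *: u + x)).
have dk (b : R) : 0 <= b <= d -> is_derive b 1 k ('D_v ('D_u f) (b *: v + (s *: u + x))).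
  move=> bd; apply: is_derive_line; apply: (ddf u).1.
  by rewrite addrCA; exact: HD.
have [t td] := MVT d0 (fun a ai => dk a (i2c _ ai)) (derivable_within_continuous
   (fun a (ai : a \in `[0, d]%R) => @ex_derive _ _ _ _ _ _ _
     (dk a ltac:(by move: ai; rewrite in_itv)))).
rewrite subr0 /k scale0r !add0r => kE.
by exists s, t; split=> //; [exact: i2c|rewrite addrCA kE addrCA].
Qed.

(** The second difference over a small parallelogram is symmetric in u and v. It equals d * d times
    either mixed derivative at points near x, and both mixed derivatives are continuous at x. *)
Lemma schwarz x u v : open D -> D x -> class_C 2 D f ->
  'D_u ('D_v f) x = 'D_v ('D_u f) x.
Proof.
move=> oD Dx Cf; apply/eqP; rewrite -subr_eq0 -normr_le0; apply/ler_addgt0Pl => e e0.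
rewrite addr0.
have Cc a b : {for x, continuous ('D_a ('D_b f))} by exact: (Cf.2 b).2.
have e20 : 0 < e / 2 by rewrite divr_gt0.
have [r r0 rP] := near_two_continuous oD Dx (Cc u v) (Cc v u) e20.
have n0 : 0 < `|u| + `|v| + 1 by rewrite ltr_wpDl// addr_ge0.
(* The parallelogram with sides [d *: u] and [d *: v] lies in the ball of radius r. The summand 1
   keeps the denominator positive and the inequality strict. *)
pose d := r / (`|u| + `|v| + 1).
have d0 : 0 < d by rewrite divr_gt0.
have inb s t : 0 <= s <= d -> 0 <= t <= d -> ball x r (s *: u + (t *: v + x)).
  move=> /andP[s0 sd] /andP[t0 td]; rewrite -ball_normE/= addrA opprD addrCA subrr addr0 normrN.
  rewrite (le_lt_trans (ler_normD _ _))// !normrZ !ger0_norm//.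
  have : s * `|u| + t * `|v| <= d * (`|u| + `|v|).
    by rewrite mulrDr lerD// ler_wpM2r.
  move/le_lt_trans; apply; rewrite /d mulrAC ltr_pdivrMr// ltr_pM2l//.
  by rewrite ltrDl.
have [s [t [sd td E1]]] := second_difference d0 Cf
  (fun s t sd td => let: And3 p _ _ := rP _ (inb s t sd td) in p).
have inb' s' t' : 0 <= s' <= d -> 0 <= t' <= d -> ball x r (s' *: v + (t' *: u + x)).
  by move=> s'd t'd; rewrite addrCA; exact: inb.
have [s' [t' [s'd t'd E2]]] := second_difference d0 Cf
  (fun s t sd td => let: And3 p _ _ := rP _ (inb' s t sd td) in p).
have [_ _ b1] := rP _ (inb _ _ sd td).
have [_ b2 _] := rP _ (inb' _ _ s'd t'd).
move: E1 E2; rewrite addrCA => E1 E2; move: b1 b2 E1 E2.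
move: ('D_v ('D_u f) x) ('D_v ('D_u f) (s *: u + (t *: v + x)))
  ('D_u ('D_v f) x) ('D_u ('D_v f) (s' *: v + (t' *: u + x))).
(* Up to reordering, E1 and E2 have the same left-hand side; cancel d twice. The two errors of e / 2
   then add up to e. *)
move=> p0 p q0 q b1 b2 E1 E2; have pq : p = q.
  apply: (mulIf (lt0r_neq0 d0)); apply: (mulIf (lt0r_neq0 d0)).
  apply: etrans (esym E1) (etrans _ E2).
  by rewrite !opprB addrACA [RHS]addrACA [in RHS](addrC (- f _)).
rewrite pq distrC in b1; rewrite -(subrKA q).
by rewrite (le_trans (ler_normD _ _))// (splitr e) lerD.
Qed.
End Schwarz.

Lemma class_C_mx (E : normedModType R) m n k (D : set E) (f : E -> 'M[R]_(m, n)) i j :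
  open D -> class_C k D f -> class_C k D (fun y => f y i j).
Proof.
have linL : linear (fun M : 'M[R]_(m, n) => M i j : R^o).
  by move=> a u v; rewrite !mxE.
pose L : {linear 'M[R]_(m, n) -> R^o} :=
  HB.pack (fun M : 'M[R]_(m, n) => M i j : R^o) (GRing.isLinear.Build R _ _ _ _ linL).
exact: (class_C_linear L).
Qed.

(** The mean value theorem needs real values, so the argument goes entry by entry. *)
Lemma schwarz_mx (E : normedModType R) m n (D : set E) (f : E -> 'M[R]_(m, n)) x u v :
  open D -> D x -> class_C 2 D f -> 'D_u ('D_v f) x = 'D_v ('D_u f) x.
Proof.
move=> oD Dx Cf; have [df ddf] := Cf.
have coord a b i j : ('D_a ('D_b f) x) i j = 'D_a ('D_b (fun y => f y i j)) x.
  rewrite (derive_mx (@diff_derivable _ _ _ _ _ a ((ddf b).1 _ Dx))) mxE.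
  apply: near_eq_derive; near=> y.
  rewrite (derive_mx (@diff_derivable _ _ _ _ _ b (df y _))) ?mxE//.
  by near: y; exact: open_nbhs_nbhs.
apply/matrixP => i j; apply: etrans (coord u v i j) (etrans _ (esym (coord v u i j))).
exact: (schwarz u v oD Dx (class_C_mx i j oD Cf)).
Unshelve. all: by end_near. Qed.

(** Expansion in the standard basis moves the direction into real coefficients, so that a direction
    depending on the point can be handled by the product rule. *)
Lemma derive_row_sum (F : normedModType R) d (f : 'rV[R]_d -> F) x v :
  differentiable f x -> 'D_v f x = \sum_j v 0 j *: 'D_(delta_mx 0 j) f x.
Proof.
move=> df; rewrite deriveE// {1}(row_sum_delta v) linear_sum.
by apply: eq_bigr => j _; rewrite linearZ deriveE.
Qed.

(* The direction xi is allowed to vary with the point; this is the source of the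
   first-order term in the product of two invariant fields. *)
Lemma is_derive_field (F : normedModType R) d (D : set 'rV[R]_d) (f : 'rV[R]_d -> F)
    (xi : 'rV[R]_d -> 'rV[R]_d) x v :
  open D -> D x -> class_C 2 D f -> derivable xi x v ->
  is_derive x v (fun y => 'D_(xi y) f y) ('D_v ('D_(xi x) f) x + 'D_('D_v xi x) f x).
Proof.
move=> oD Dx [df ddf] dxi.
have sumE : \forall y \near x,
    (\sum_j (fun z => xi z 0 j *: 'D_(delta_mx 0 j) f z)) y = 'D_(xi y) f y.
  near=> y; rewrite fct_sumE derive_row_sum//; apply: df.
  by near: y; exact: open_nbhs_nbhs.
apply: (near_eq_is_derive sumE).
have -> : 'D_v ('D_(xi x) f) x + 'D_('D_v xi x) f x =
  \sum_j (xi x 0 j *: 'D_v ('D_(delta_mx 0 j) f) x + 'D_v xi x 0 j *: 'D_(delta_mx 0 j) f x).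
  rewrite big_split/= -derive_row_sum; last exact: df.
  congr (_ + _).
  have -> : 'D_v ('D_(xi x) f) x = 'D_v (\sum_j (xi x 0 j \*: 'D_(delta_mx 0 j) f)) x.
    apply: near_eq_derive; near=> y; rewrite fct_sumE derive_row_sum//; apply: df.
    by near: y; exact: open_nbhs_nbhs.
  have dj j : derivable (xi x 0 j \*: 'D_(delta_mx 0 j) f) x v.
    by apply/derivableZ/diff_derivable/(ddf _).1.
  rewrite derive_sum//; apply: eq_bigr => j _; rewrite deriveZ//.
  exact/diff_derivable/(ddf _).1.
apply: is_derive_sum => j; apply: is_derive_scale.
  by rewrite (derive_mx dxi) mxE; apply: derivableP; move/derivable_mxP: dxi; apply.
exact/derivableP/diff_derivable/(ddf _).1.
Unshelve. all: by end_near. Qed.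
End Calculus.

(* Otherwise unification unfolds iterated directional derivatives down to the
   definition of limits and does not terminate in practice. *)
Opaque derive derivable.

(** * Smooth cochains in charts *)

Section ConsRow.
Context {R : realType} {d : nat}.

(** The counterpart of [cons_arg] in coordinates. It is affine in each argument, so a partial
    derivative in the first slot is a directional derivative along [cons_row X 0]. *)
Definition cons_row n (z : 'rV[R]_d) (y : 'M[R]_(n, d)) : 'M[R]_(n.+1, d) :=
  \matrix_(i, j) oapp (fun k => y k j) (z 0 j) (unlift ord0 i).

Lemma row0_cons n z (y : 'M[R]_(n, d)) : row ord0 (cons_row z y) = z.
Proof. by apply/rowP => j; rewrite !mxE unlift_none. Qed.

Lemma rowS_cons n z (y : 'M[R]_(n, d)) i :
  row (lift ord0 i) (cons_row z y) = row i y.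
Proof. by apply/rowP => j; rewrite !mxE liftK. Qed.

Lemma cons_row_affine1 n (y : 'M[R]_(n, d)) (h : R) v z :
  cons_row (h *: v + z) y = h *: cons_row v 0 + cons_row z y.
Proof.
by apply/matrixP => i j; rewrite !mxE; case: unliftP => [k|] _ /=; rewrite ?mxE ?mulr0 ?add0r.
Qed.

Lemma cons_row_affine2 n (z : 'rV[R]_d) (h : R) (v y : 'M[R]_(n, d)) :
  cons_row z (h *: v + y) = h *: cons_row 0 v + cons_row z y.
Proof.
by apply/matrixP => i j; rewrite !mxE; case: unliftP => [k|] _ /=; rewrite ?mxE ?mulr0 ?add0r.
Qed.

Lemma chart_inv_pow_cons n (M : manifoldType R d) c0 (c : 'I_n -> chart R d M) z y :
  chart_inv_pow (cons_arg c0 c) (cons_row z y) =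
  cons_arg (chart_inv c0 z) (chart_inv_pow c y).
Proof.
apply/funext => i; rewrite /chart_inv_pow /cons_arg.
by case: (unliftP ord0 i) => [k|] -> /=; rewrite ?rowS_cons// row0_cons.
Qed.

Lemma chart_img_pow_cons n (M : manifoldType R d) c0 (c : 'I_n -> chart R d M) z y :
  chart_img c0 z -> chart_img_pow c y ->
  chart_img_pow (cons_arg c0 c) (cons_row z y).
Proof.
move=> c0z cy i; rewrite /cons_arg.
by case: (unliftP ord0 i) => [k|] -> /=; rewrite ?rowS_cons// row0_cons.
Qed.

Lemma chart_invK (M : manifoldType R d) (c : chart R d M) y :
  chart_img c y -> chart_map c (chart_inv c y) = y.
Proof. by move=> [x xc <-]; rewrite chart_mapK. Qed.

Lemma chart_inv_dom (M : manifoldType R d) (c : chart R d M) y :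
  chart_img c y -> chart_dom c (chart_inv c y).
Proof. by move=> [x xc <-]; rewrite chart_mapK. Qed.

Definition chart_at (M : manifoldType R d) (x : M) : chart R d M :=
  projT1 (cid (atlas_cover x)).

Lemma atlas_chart_at (M : manifoldType R d) (x : M) : atlas (chart_at x).
Proof. by have [] := projT2 (cid (atlas_cover x)). Qed.

Lemma chart_at_dom (M : manifoldType R d) (x : M) : chart_dom (chart_at x) x.
Proof. by have [] := projT2 (cid (atlas_cover x)). Qed.

Lemma cons_argE T n (x : 'I_n.+1 -> T) : cons_arg (x ord0) (x \o lift ord0) = x.
Proof.
by apply/funext => i; rewrite /cons_arg; case: (unliftP ord0 i) => [k|] -> //.
Qed.

Lemma cons_arg0 T n t (x : 'I_n -> T) : cons_arg t x ord0 = t.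
Proof. by rewrite /cons_arg unlift_none. Qed.

Lemma cons_argS T n t (x : 'I_n -> T) : cons_arg t x \o lift ord0 = x.
Proof. by apply/funext => i; rewrite /cons_arg/= liftK. Qed.

Lemma map_cons_arg S T n (f : S -> T) t (x : 'I_n -> S) :
  f \o cons_arg t x = cons_arg (f t) (f \o x).
Proof.
by apply/funext => i; rewrite /cons_arg/=; case: (unliftP ord0 i).
Qed.
End ConsRow.

Section SmoothSlot.
Context {R : realType} {d : nat} {V : vectType R}.

Definition smooth1 (M : manifoldType R d) (phi : M -> V) : Prop :=
  forall c : chart R d M, atlas c ->
    class_Coo (chart_img c) (fun z => v2r (phi (chart_inv c z))).

(** Charts around the entries of g turn fixing the remaining arguments into an affine insertion of
    constant rows. *)
Lemma smooth1_slot (M : manifoldType R d) n (f : ('I_n.+1 -> M) -> V) g :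
  smooth_vec f -> smooth1 (fun h => f (cons_arg h g)).
Proof.
move=> sf c0 c0a k; pose c := fun i => chart_at (g i).
pose y : 'M[R]_(n, d) := \matrix_i chart_map (c i) (g i).
have ca i : atlas (cons_arg c0 c i).
  by rewrite /cons_arg; case: unlift => //= j; exact: atlas_chart_at.
have -> : (fun z => v2r (f (cons_arg (chart_inv c0 z) g))) =
    (fun y => v2r (f (chart_inv_pow (cons_arg c0 c) y))) \o (fun z => cons_row z y).
  apply/funext => z /=; rewrite chart_inv_pow_cons; congr (v2r (f (cons_arg _ _))).
  by apply/funext => i; rewrite /chart_inv_pow rowK chart_mapK//; exact: chart_at_dom.
apply: (class_C_affine (cons_row_affine1 y)) (sf _ ca k).
  exact: (affine_differentiable (cons_row_affine1 y)).
move=> z c0z; apply: chart_img_pow_cons => // i.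
by rewrite rowK; exists (g i) => //; exact: chart_at_dom.
Qed.

Lemma smooth_vec_lin (M : manifoldType R d) n a (f g : ('I_n -> M) -> V) :
  smooth_vec f -> smooth_vec g -> smooth_vec (a *: f + g).
Proof.
move=> sf sg c ca k; apply: (class_C_lin (a := a) _ (sf c ca k) (sg c ca k)) => [|y _].
  exact: open_chart_img_pow.
by rewrite !fctE linearP.
Qed.
End SmoothSlot.

Section Operators.
Context {R : realType} {d : nat} {G : lieGroupType R d}.
Implicit Types X Y : Lie G.
Local Notation c1 := (chart1 G).
Local Notation o := (coord1 G).

Lemma atlas_chart1 : atlas c1. Proof. exact: atlas_chart_at. Qed.
Lemma chart_inv_coord1 : chart_inv c1 o = 1%g.
Proof. by rewrite chart_mapK//; exact: chart_at_dom. Qed.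
Lemma chart_img_coord1 : chart_img c1 o.
Proof. by exists 1%g => //; exact: chart_at_dom. Qed.

Lemma near_coord1 : \forall z \near o, chart_img c1 z.
Proof.
apply: open_nbhs_nbhs; split; [exact: open_chart_img|exact: chart_img_coord1].
Qed.

Lemma derive_near_id (xi : 'rV[R]_d -> 'rV[R]_d) (X : 'rV[R]_d) :
  (forall z, chart_img c1 z -> xi z = z) -> 'D_X xi o = X.
Proof.
move=> xiE; rewrite -[RHS](derive_id o X); apply: near_eq_derive.
by apply: filterS near_coord1 => z zc; rewrite xiE.
Qed.

Lemma right_field_coord1 X : right_field X o = X.
Proof.
apply: derive_near_id => z zc.
by rewrite /= chart_inv_coord1 mulg1 chart_invK.
Qed.

Lemma left_field_coord1 X : left_field X o = X.
Proof.
apply: derive_near_id => z zc.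
by rewrite /= chart_inv_coord1 mul1g chart_invK.
Qed.

Context {V : vectType R}.

Lemma smooth1_coord (phi : G -> V) : smooth1 phi ->
  class_Coo (chart_img c1) (fun z => v2r (phi (chart_inv c1 z))).
Proof. by apply; exact: atlas_chart1. Qed.

Definition first_slot n (f : ('I_n.+1 -> G) -> V) g :=
  fun z => v2r (f (cons_arg (chart_inv c1 z) g)).

Lemma R_opE n X (f : ('I_n.+1 -> G) -> V) g :
  R_op X f g = r2v ('D_(X : 'rV[R]_d) (first_slot f g) o).
Proof. by rewrite /R_op right_field_coord1. Qed.

(** Both derivatives act on the same slot, along directions that are constant in the chart. This
    term depends on the chart; being symmetric in X and Y, it cancels in the antisymmetrization. *)
Definition R2_op n X Y (f : ('I_n.+1 -> G) -> V) : ('I_n -> G) -> V :=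
  fun g => r2v ('D_(Y : 'rV[R]_d) ('D_(X : 'rV[R]_d) (first_slot f g)) o).

Lemma first_slot_cons_row n (f : ('I_n.+1 -> G) -> V) (c : 'I_n -> chart R d G) y :
  first_slot f (chart_inv_pow c y) =
    (fun y => v2r (f (chart_inv_pow (cons_arg c1 c) y))) \o (fun z => cons_row z y).
Proof. by apply/funext => z; rewrite /= chart_inv_pow_cons. Qed.

Lemma class_C_slot (E : normedModType R) n k (F : 'M[R]_(n.+1, d) -> E) (c : 'I_n -> chart R d G) :
  class_C k (chart_img_pow (cons_arg c1 c)) F ->
  class_C k (chart_img_pow c) (F \o cons_row o).
Proof.
apply: (class_C_affine (cons_row_affine2 o)).
  exact: (affine_differentiable (cons_row_affine2 o)).
move=> y cy; apply: chart_img_pow_cons => //; exact: chart_img_coord1.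
Qed.

Lemma atlas_cons n (c : 'I_n -> chart R d G) :
  (forall i, atlas (c i)) -> forall i, atlas (cons_arg c1 c i).
Proof.
by move=> ca i; rewrite /cons_arg; case: unlift => //=; exact: atlas_chart1.
Qed.

(** In charts, [R_op] is a directional derivative followed by restriction of the first row to the
    coordinates of 1, and both preserve smoothness. *)
Lemma smooth_R_op n X (f : ('I_n.+1 -> G) -> V) : smooth_vec f -> smooth_vec (R_op X f).
Proof.
move=> sf c ca k; have Cf := class_Coo_derive (cons_row (X : 'rV[R]_d) 0) (sf _ (atlas_cons ca)).
under eq_fun => y.
  rewrite R_opE r2vK first_slot_cons_row (derive_affine_at (cons_row_affine1 y)).
  over.
exact: class_C_slot (Cf k).
Qed.

Lemma smooth_R2_op n X Y (f : ('I_n.+1 -> G) -> V) :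
  smooth_vec f -> smooth_vec (R2_op X Y f).
Proof.
move=> sf c ca k; have Cf := class_Coo_derive (cons_row (Y : 'rV[R]_d) 0)
  (class_Coo_derive (cons_row (X : 'rV[R]_d) 0) (sf _ (atlas_cons ca))).
under eq_fun => y.
  rewrite r2vK first_slot_cons_row (derive_affine (cons_row_affine1 y))
    (derive_affine_at (cons_row_affine1 y)).
  over.
exact: class_C_slot (Cf k).
Qed.
End Operators.

(** * Second derivative of the multiplication *)

Section Multiplication.
Context {R : realType} {d : nat} {G : lieGroupType R d}.
Implicit Types X Y : Lie G.
Local Notation c1 := (chart1 G).
Local Notation o := (coord1 G).

(** The first factor is read in the chart at 1, where derivatives are taken. The chart c of the
    second factor also serves for the product, since g * h stays near h for g near 1. *)
Definition charts2 (c : chart R d G) : 'I_2 -> chart R d G :=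
  cons_arg c1 (fun _ : 'I_1 => c).

Local Notation mul_pow c :=
  ((fun x : 'I_2 -> G => (x ord0 * x ord_max)%g) \o chart_inv_pow (charts2 c)).

Definition mul2 c : 'M[R]_(2, d) -> 'rV[R]_d := chart_map c \o mul_pow c.

Definition dom2 c : set 'M[R]_(2, d) :=
  chart_img_pow (charts2 c) `&` mul_pow c @^-1` chart_dom c.

Lemma chart_inv_pow2 c (z y : 'rV[R]_d) :
  chart_inv_pow (charts2 c) (cons_row z y) ord0 = chart_inv c1 z /\
  chart_inv_pow (charts2 c) (cons_row z y) ord_max = chart_inv c y.
Proof.
rewrite /charts2 chart_inv_pow_cons cons_arg0; split=> //.
have -> : ord_max = lift ord0 ord0 :> 'I_2 by apply/val_inj.
by rewrite /cons_arg liftK /= /chart_inv_pow row_id.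
Qed.

Lemma mul2_cons c z y : mul2 c (cons_row z y) = chart_map c (chart_inv c1 z * chart_inv c y)%g.
Proof. by rewrite /mul2 /=; have [-> ->] := chart_inv_pow2 c z y. Qed.

Lemma dom2_cons c z y : chart_img c1 z -> chart_img c y ->
  chart_dom c (chart_inv c1 z * chart_inv c y)%g -> dom2 c (cons_row z y).
Proof.
move=> zc yc zy; split; last by rewrite /preimage/=; have [-> ->] := chart_inv_pow2 c z y.
by apply: chart_img_pow_cons => // i; rewrite row_id.
Qed.

Lemma dom2_dom c z y : dom2 c (cons_row z y) -> chart_dom c (chart_inv c1 z * chart_inv c y)%g.
Proof. by move=> [_]; rewrite /preimage/=; have [-> ->] := chart_inv_pow2 c z y. Qed.

Lemma smooth_mul2 c : atlas c -> open (dom2 c) /\ class_Coo (dom2 c) (mul2 c).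
Proof.
move=> ca; have ca2 : forall i, atlas (charts2 c i).
  by move=> i; rewrite /charts2 /cons_arg; case: unlift => //=; exact: atlas_chart1.
exact: (@smooth_mulg R d G _ ca2 _ ca).
Qed.

Lemma dom2_coord1 c y : chart_img c y -> dom2 c (cons_row o y).
Proof.
move=> yc; apply: dom2_cons => //; first exact: chart_img_coord1.
by rewrite chart_inv_coord1 mul1g; exact: chart_inv_dom.
Qed.

Lemma mul2_coord1 c y : chart_img c y -> mul2 c (cons_row o y) = y.
Proof. by move=> yc; rewrite mul2_cons chart_inv_coord1 mul1g chart_invK. Qed.

Lemma near_dom2 c y : atlas c -> chart_img c y -> \forall z \near o, dom2 c (cons_row z y).
Proof.
move=> ca yc; have [oD _] := smooth_mul2 ca.
have : {for o, continuous (fun z => cons_row z y)}.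
  exact/differentiable_continuous/(affine_differentiable (cons_row_affine1 y)).
by apply; apply: open_nbhs_nbhs; split=> //; exact: dom2_coord1.
Qed.

Lemma right_field_mul2 X y :
  right_field X y = 'D_(cons_row (X : 'rV[R]_d) 0) (mul2 c1) (cons_row o y).
Proof.
rewrite -(derive_affine_at (cons_row_affine1 y)) /right_field /tangent1.
suff -> : mul2 c1 \o (fun z => cons_row z y) =
  (fun g => chart_map c1 (g * chart_inv c1 y)%g) \o chart_inv c1 by [].
by apply/funext => z; exact: mul2_cons.
Qed.

Lemma left_field_mul2 X y :
  left_field X y = 'D_(cons_row 0 (X : 'rV[R]_d)) (mul2 c1) (cons_row y o).
Proof.
rewrite -(derive_affine_at (cons_row_affine2 y)) /left_field /tangent1.
suff -> : mul2 c1 \o (fun z => cons_row y z) =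
  (fun g => chart_map c1 (chart_inv c1 y * g)%g) \o chart_inv c1 by [].
by apply/funext => z; exact: mul2_cons.
Qed.

Lemma derive_right_field X Y : 'D_(Y : 'rV[R]_d) (right_field X) o =
  'D_(cons_row 0 (Y : 'rV[R]_d)) ('D_(cons_row (X : 'rV[R]_d) 0) (mul2 c1)) (cons_row o o).
Proof.
rewrite -(derive_affine_at (cons_row_affine2 o)).
suff -> : right_field X = 'D_(cons_row (X : 'rV[R]_d) 0) (mul2 c1) \o (fun y => cons_row o y) by [].
by apply/funext => y; exact: right_field_mul2.
Qed.

Lemma derive_left_field X Y : 'D_(Y : 'rV[R]_d) (left_field X) o =
  'D_(cons_row (Y : 'rV[R]_d) 0) ('D_(cons_row 0 (X : 'rV[R]_d)) (mul2 c1)) (cons_row o o).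
Proof.
rewrite -(derive_affine_at (cons_row_affine1 o)).
suff -> : left_field X = 'D_(cons_row 0 (X : 'rV[R]_d)) (mul2 c1) \o (fun y => cons_row y o) by [].
by apply/funext => y; exact: left_field_mul2.
Qed.

Lemma derivable_right_field X Y : derivable (right_field X) o (Y : 'rV[R]_d).
Proof.
have [oD Cm] := smooth_mul2 atlas_chart1.
rewrite (_ : right_field X =
  'D_(cons_row (X : 'rV[R]_d) 0) (mul2 c1) \o (fun y => cons_row o y)); last first.
  by apply/funext => y; exact: right_field_mul2.
apply: (derivable_affine (cons_row_affine2 o)); apply: diff_derivable.
apply: class_Coo_differentiable (class_Coo_derive _ Cm) _.
by apply: dom2_coord1; exact: chart_img_coord1.
Qed.

(** By [derive_right_field] this is the mixed second derivative of the multiplication at (1, 1),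
    along X in the first factor and Y in the second. *)
Definition mul_hessian X Y : Lie G := 'D_(Y : 'rV[R]_d) (right_field X) o.

(* Symmetry of the second derivative of the multiplication turns the left
   invariant fields of the bracket into right invariant ones. *)
Lemma Lie_bracketE X Y : Lie_bracket X Y = mul_hessian X Y - mul_hessian Y X.
Proof.
have [oD Cm] := smooth_mul2 atlas_chart1.
have Do : dom2 c1 (cons_row o o) by apply: dom2_coord1; exact: chart_img_coord1.
rewrite /Lie_bracket /field_bracket !left_field_coord1.
have sym (U T : Lie G) : 'D_(U : 'rV[R]_d) (left_field T) o = mul_hessian U T.
  rewrite /mul_hessian derive_left_field (derive_right_field U T).
  exact: schwarz_mx oD Do (Cm 2).
exact: (congr2 (fun a b : 'rV[R]_d => a - b) (sym X Y) (sym Y X)).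
Qed.

Section Translate.
Context {V : vectType R} (phi : G -> V) (sphi : smooth1 phi).

(** Chain rule: near the identity, the translated function is phi read in the chart c, composed with
    the multiplication by the point of coordinates y. *)
Lemma translate_chart X c y : atlas c -> chart_img c y ->
  differentiable (fun z => v2r (phi (chart_inv c1 z * chart_inv c y)%g)) o /\
  'D_(X : 'rV[R]_d) (fun z => v2r (phi (chart_inv c1 z * chart_inv c y)%g)) o =
  'D_('D_(X : 'rV[R]_d) (fun z => mul2 c (cons_row z y)) o)
     (fun z => v2r (phi (chart_inv c z))) y.
Proof.
move=> ca yc; have [oD Cm] := smooth_mul2 ca.
pose F z := v2r (phi (chart_inv c z)).
pose M z := mul2 c (cons_row z y).
have FM : {near o, F \o M =1 (fun z => v2r (phi (chart_inv c1 z * chart_inv c y)%g))}.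
  apply: filterS (near_dom2 ca yc) => z /dom2_dom zy.
  by rewrite /F /M /= mul2_cons chart_mapK.
have My : M o = y by rewrite /M mul2_coord1.
have dM : differentiable M o.
  rewrite (_ : M = mul2 c \o (fun z => cons_row z y)); last by [].
  apply: differentiable_comp; first exact: (affine_differentiable (cons_row_affine1 y)).
  apply: class_Coo_differentiable Cm _; exact: dom2_coord1.
have dF : differentiable F (M o).
  by rewrite My; apply: class_Coo_differentiable (sphi ca) _.
split; first by apply: near_eq_differentiable FM _; exact: differentiable_comp.
by rewrite -(near_eq_derive _ FM) derive_comp// My.
Qed.

Lemma derivable_translate X h :
  derivable (fun z => v2r (phi (chart_inv c1 z * h)%g)) o (X : 'rV[R]_d).
Proof.
have [] := translate_chart X (atlas_chart_at h) (y := chart_map (chart_at h) h).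
  by exists h => //; exact: chart_at_dom.
by rewrite chart_mapK; [move=> /diff_derivable|exact: chart_at_dom].
Qed.

Local Notation F := (fun z => v2r (phi (chart_inv c1 z))).

(** For y near the identity, the inner derivative is that of F at y along the right invariant field.
    Differentiating in y also moves the direction, and [is_derive_field] turns this into the term
    with [mul_hessian]. *)
Lemma is_derive_translate X Y : is_derive o (Y : 'rV[R]_d)
  (fun y => 'D_(X : 'rV[R]_d) (fun z => v2r (phi (chart_inv c1 z * chart_inv c1 y)%g)) o)
  ('D_(Y : 'rV[R]_d) ('D_(X : 'rV[R]_d) F) o + 'D_(mul_hessian X Y : 'rV[R]_d) F o).
Proof.
have E : \forall y \near o, 'D_(right_field X y) F y =
   'D_(X : 'rV[R]_d) (fun z => v2r (phi (chart_inv c1 z * chart_inv c1 y)%g)) o.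
  apply: filterS near_coord1 => y yc; have [_ ->] := translate_chart X atlas_chart1 yc.
  by rewrite right_field_mul2 -(derive_affine_at (cons_row_affine1 y)).
apply: (near_eq_is_derive E).
have := is_derive_field (open_chart_img (c := c1)) chart_img_coord1
  (smooth1_coord sphi 2) (@derivable_right_field X Y).
by rewrite right_field_coord1.
Qed.
End Translate.
End Multiplication.

(** * Iterated derivatives *)

Section MergeWith.
Context {T : Type} (op : T -> T -> T).

(* [merge_arg] for an arbitrary product, to be used with the Lie bracket. *)
Definition merge_with n (i : 'I_n) (g : 'I_n.+1 -> T) : 'I_n -> T :=
  fun j => if (j < i)%N then g (lift ord_max j)
           else if j == i then op (g (lift ord_max j)) (g (lift ord0 j))
           else g (lift ord0 j).

(** Throughout, [lift ord_max i] is the index of value i and [lift ord0 i] that of value i + 1: the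
    two slots merged by [merge_with]. *)
Lemma lift_max0 n : lift ord_max (ord0 : 'I_n.+1) = ord0 :> 'I_n.+2.
Proof. exact/val_inj. Qed.

Lemma lift_maxS n (i : 'I_n) :
  lift ord_max (lift ord0 i) = lift ord0 (lift ord_max i) :> 'I_n.+2.
Proof.
by apply/val_inj; rewrite /= /bump /= !add1n ltnS addnS.
Qed.

Lemma merge_with_cons0 n a (g : 'I_n.+1 -> T) :
  merge_with ord0 (cons_arg a g) = cons_arg (op a (g ord0)) (g \o lift ord0).
Proof.
apply/funext => j; rewrite /merge_with; case: (unliftP ord0 j) => [k|] -> /=.
  by rewrite /cons_arg /= !liftK.
by rewrite lift_max0 cons_arg0 /cons_arg liftK unlift_none.
Qed.

Lemma merge_with_consS n (i : 'I_n) a (g : 'I_n.+1 -> T) :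
  merge_with (lift ord0 i) (cons_arg a g) = cons_arg a (merge_with i g).
Proof.
apply/funext => j; rewrite /merge_with; case: (unliftP ord0 j) => [k|] ->; last first.
  by rewrite /= cons_arg0 lift_max0 cons_arg0.
rewrite lift_maxS /= (inj_eq (@lift_inj _ ord0)) /cons_arg /= !liftK /=.
by rewrite /bump /= !add1n ltnS.
Qed.
End MergeWith.

Lemma merge_argE (G : groupType) n (i : 'I_n) (g : 'I_n.+1 -> G) :
  merge_arg i g = merge_with (fun x y => (x * y)%g) i g.
Proof. by []. Qed.

Section ProductOfOperators.
Context {R : realType} {d : nat} {G : lieGroupType R d}.
Local Notation c1 := (chart1 G).
Local Notation o := (coord1 G).

Section OneModule.
Context {V : vectType R}.

(* The differential of a cochain is not shown to be smooth: all that is needed is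
   that the derivatives taken by [R_prod] exist. *)
Fixpoint prod_derivable n : ('I_n -> Lie G) -> (('I_n -> G) -> V) -> Prop :=
  match n with
  | 0 => fun _ _ => True
  | m.+1 => fun X f => (forall g, derivable (first_slot f g) o (X ord0 : 'rV[R]_d)) /\
                       prod_derivable (X \o lift ord0) (R_op (X ord0) f)
  end.

Lemma first_slot_lin n a (f f' : ('I_n.+1 -> G) -> V) g :
  first_slot (a *: f + f') g = a \*: first_slot f g + first_slot f' g.
Proof. by apply/funext => z; rewrite /first_slot !fctE linearP. Qed.

Lemma R_op_lin n a (X : Lie G) (f f' : ('I_n.+1 -> G) -> V) :
  (forall g, derivable (first_slot f g) o (X : 'rV[R]_d)) ->
  (forall g, derivable (first_slot f' g) o (X : 'rV[R]_d)) ->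
  R_op X (a *: f + f') = a *: R_op X f + R_op X f'.
Proof.
move=> df df'; apply/funext => g; rewrite !fctE !R_opE first_slot_lin.
by rewrite (deriveD (derivableZ (df g)) (df' g)) (deriveZ a (df g)) linearP.
Qed.

Lemma prod_derivable_lin n a (X : 'I_n -> Lie G) (f f' : ('I_n -> G) -> V) :
  prod_derivable X f -> prod_derivable X f' -> prod_derivable X (a *: f + f').
Proof.
elim: n X f f' => //= n IH X f f' [df pf] [df' pf']; split.
  by move=> g; rewrite first_slot_lin; apply: derivableD; first exact: derivableZ.
by rewrite (R_op_lin a df df'); exact: IH.
Qed.

Lemma R_prod_lin n a (X : 'I_n -> Lie G) (f f' : ('I_n -> G) -> V) :
  prod_derivable X f -> prod_derivable X f' ->
  R_prod X (a *: f + f') = a *: R_prod X f + R_prod X f'.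
Proof.
elim: n X f f' => //= n IH X f f' [df pf] [df' pf'].
by rewrite (R_op_lin a df df'); exact: IH.
Qed.

Lemma smooth_derivable n (f : ('I_n.+1 -> G) -> V) g : smooth_vec f ->
  differentiable (first_slot f g) o.
Proof.
move=> sf; exact: (class_Coo_differentiable (smooth1_coord (smooth1_slot g sf)) chart_img_coord1).
Qed.

Lemma prod_derivable_smooth n (X : 'I_n -> Lie G) (f : ('I_n -> G) -> V) :
  smooth_vec f -> prod_derivable X f.
Proof.
elim: n X f => //= n IH X f sf; split; last exact/IH/smooth_R_op.
by move=> g; apply: diff_derivable; exact: smooth_derivable.
Qed.

Lemma R_op_lin_dir n a (X Y : Lie G) (f : ('I_n.+1 -> G) -> V) : smooth_vec f ->
  R_op (a *: X + Y) f = a *: R_op X f + R_op Y f.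
Proof.
move=> sf; apply/funext => g; rewrite !fctE !R_opE -linearP derive_linear_dir//.
exact: smooth_derivable.
Qed.

Lemma R_prod_multilinear n (f : ('I_n -> G) -> V) :
  smooth_vec f -> multilinear (fun X : 'I_n -> Lie G => R_prod X f).
Proof.
elim: n f => [|n IH] f sf i x a u v; first by case: i.
(* Changing entry i of x changes either the first direction or one entry of the tail. *)
have tail (w : Lie G) : [eta x with i |-> w] \o lift ord0 =
    if unlift ord0 i is Some j then [eta x \o lift ord0 with j |-> w] else x \o lift ord0.
  apply/funext => k /=; case: unliftP => [j|] -> //=.
rewrite /= !tail; move: tail => _; case: unliftP => [j|] -> /=.
  by apply: IH; exact: smooth_R_op.
by rewrite R_op_lin_dir// R_prod_lin//; apply: prod_derivable_smooth; exact: smooth_R_op.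
Qed.

Lemma vanEst_CE n (f : ('I_n -> G) -> V) :
  smooth_vec f -> CE_cochains (vanEst f : ('I_n -> Lie G) -> V).
Proof.
move=> sf; split=> [i x a u v|x i j ij xij].
  rewrite /vanEst scaler_sumr -big_split/=; apply: eq_bigr => s _.
  have E w : [eta x with i |-> w] \o s = [eta x \o s with (s^-1)%g i |-> w].
    by apply/funext => k /=; rewrite -(inj_eq (@perm_inj _ s)) permKV.
  by rewrite !E (R_prod_multilinear sf) scalerDr !scalerA mulrC.
(* Multiplying s by [tperm i j] flips its sign but preserves [x \o s], because x takes equal values
   at i and j. Then 2 is cancelled. *)
suff : vanEst f x = - vanEst f x.
  move/eqP; rewrite -addr_eq0 -mulr2n -scaler_nat scaler_eq0 pnatr_eq0 /=.
  by move/eqP.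
rewrite {1}/vanEst (reindex_inj (mulIg (tperm i j))) /= -sumrN.
apply: eq_bigr => s _; rewrite -scaleNr odd_permM odd_tperm ij addbT signrN.
congr (_ *: R_prod _ _); apply/funext => k /=; rewrite permM.
by case: tpermP => [->|->|].
Qed.
End OneModule.
End ProductOfOperators.

(** * Terms of the group differential *)

Section Terms.
Context {R : realType} {d : nat} {G : lieGroupType R d}.
Local Notation c1 := (chart1 G).
Local Notation o := (coord1 G).

(** In coordinates A is a linear map on row vectors, hence continuous, and commutes with each limit
    defining a derivative. It is applied both to psi and to the infinitesimal action. *)
Lemma R_prod_linear (V W : vectType R) (A : V -> W) n (X : 'I_n -> Lie G)
    (f : ('I_n -> G) -> V) : linear A -> prod_derivable X f ->
  prod_derivable X (A \o f) /\ R_prod X (A \o f) = A (R_prod X f).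
Proof.
move=> linA; pose L v := v2r (A (r2v v)).
have linL : linear L by move=> a u v; rewrite /L linearP linA linearP.
pose L' : {linear _ -> _} := HB.pack L (GRing.isLinear.Build R _ _ _ L linL).
elim: n X f => [//|n IH] X f /= [df pf].
have slotE g : first_slot (A \o f) g = L' \o first_slot f g.
  by apply/funext => z; rewrite /first_slot /= /L v2rK.
have dA g := is_derive_linear L' (derivableP (df g)).
have -> : R_op (X ord0) (A \o f) = A \o R_op (X ord0) f.
  apply/funext => g; rewrite R_opE slotE (@derive_val _ _ _ _ _ _ _ (dA g)).
  by rewrite /= /L v2rK -R_opE.
have [pA RA] := IH _ _ pf; split=> //; split=> // g.
by rewrite slotE; have [] := dA g.
Qed.

Section Module.
Context {V : vectType R}.

(** Each slot is differentiated once, and the function is constant in the last one. *)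
Lemma R_prod_last n (X : 'I_n.+1 -> Lie G) (f : ('I_n -> G) -> V) : smooth_vec f ->
  prod_derivable X (fun g => f (g \o lift ord_max)) /\
  R_prod X (fun g => f (g \o lift ord_max)) = 0.
Proof.
elim: n X f => [|n IH] X f sf.
  have slotE g : first_slot (fun g : 'I_1 -> G => f (g \o lift ord_max)) g =
      cst (v2r (f (fun=> 1%g))).
    by apply/funext => z; congr (v2r (f _)); apply/funext => -[].
  split; first by split=> // g; rewrite slotE; exact: derivable_cst.
  by rewrite /= R_opE slotE derive_cst linear0.
have slotE g : first_slot (fun g : 'I_n.+2 -> G => f (g \o lift ord_max)) g =
    first_slot f (g \o lift ord_max).
  apply/funext => z; congr (v2r (f _)); apply/funext => j /=.
  case: (unliftP ord0 j) => [k|] ->; last by rewrite lift_max0 !cons_arg0.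
  by rewrite lift_maxS /cons_arg !liftK.
have E : R_op (X ord0) (fun g : 'I_n.+2 -> G => f (g \o lift ord_max)) =
    fun g => R_op (X ord0) f (g \o lift ord_max).
  by apply/funext => g; rewrite !R_opE slotE.
have [pl Rl] := IH (X \o lift ord0) (R_op (X ord0) f) (smooth_R_op _ sf).
split; last by rewrite -[RHS]Rl -E.
split; last by rewrite E.
by move=> g; rewrite slotE; apply: diff_derivable; exact: smooth_derivable.
Qed.

Section Action.
Context (act : G -> V -> V) (dact : Lie G -> V -> V).
(** The action is kept abstract so that the same lemmas serve the modules V and W and the pullback
    of W along the homomorphism. *)
Hypothesis act_derive : forall X v, is_derive o (X : 'rV[R]_d)
  (fun z => v2r (act (chart_inv c1 z) v)) (v2r (dact X v)).
Hypothesis dact_linear : forall X, linear (dact X).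

(** Only the action involves the first argument, so the first derivative produces [dact (X ord0)];
    the later ones pass through this linear map. *)
Lemma R_prod_first n (X : 'I_n.+1 -> Lie G) (f : ('I_n -> G) -> V) :
  smooth_vec f ->
  prod_derivable X (fun g => act (g ord0) (f (g \o lift ord0))) /\
  R_prod X (fun g => act (g ord0) (f (g \o lift ord0))) =
    dact (X ord0) (R_prod (X \o lift ord0) f).
Proof.
move=> sf; have slotE g : first_slot (fun g : 'I_n.+1 -> G => act (g ord0) (f (g \o lift ord0))) g =
    fun z => v2r (act (chart_inv c1 z) (f g)).
  by apply/funext => z; rewrite /first_slot cons_arg0 cons_argS.
have E : R_op (X ord0) (fun g : 'I_n.+1 -> G => act (g ord0) (f (g \o lift ord0))) =
    dact (X ord0) \o f.
  apply/funext => g; rewrite R_opE slotE.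
  by rewrite (@derive_val _ _ _ _ _ _ _ (act_derive _ _)) v2rK.
have [pA RA] := R_prod_linear (dact_linear (X ord0)) (prod_derivable_smooth (X \o lift ord0) sf).
rewrite /= E; split=> //; split=> // g; rewrite slotE.
by have [] := act_derive (X ord0) (f g).
Qed.
End Action.

Lemma first_slot_merge0 n (f : ('I_n.+1 -> G) -> V) g :
  first_slot (fun g => f (merge_arg ord0 g)) g =
  (fun z => v2r (f (cons_arg (chart_inv c1 z * g ord0)%g (g \o lift ord0)))).
Proof.
by apply/funext => z; rewrite /first_slot merge_argE merge_with_cons0.
Qed.

Lemma first_slot_mergeS n (i : 'I_n) (f : ('I_n.+1 -> G) -> V) g :
  first_slot (fun g => f (merge_arg (lift ord0 i) g)) g =
  first_slot f (merge_arg i g).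
Proof.
by apply/funext => z; rewrite /first_slot merge_argE merge_with_consS.
Qed.

Lemma R_op_mergeS n (i : 'I_n) X (f : ('I_n.+1 -> G) -> V) :
  R_op X (fun g => f (merge_arg (lift ord0 i) g)) = fun g => R_op X f (merge_arg i g).
Proof. by apply/funext => g; rewrite !R_opE first_slot_mergeS. Qed.

(** After merging, the first slot of f holds a product of two arguments, differentiated along X in
    the left factor and along Y in the right one: this is [is_derive_translate]. *)
Lemma R_op_R_op_merge0 n (X Y : Lie G) (f : ('I_n.+1 -> G) -> V) g : smooth_vec f ->
  is_derive o (Y : 'rV[R]_d) (first_slot (R_op X (fun g => f (merge_arg ord0 g))) g)
   (v2r (R2_op X Y f g + R_op (mul_hessian X Y) f g)).
Proof.
move=> sf; rewrite linearD R_opE /R2_op /= !r2vK.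
have := is_derive_translate (smooth1_slot g sf) X Y.
suff -> : first_slot (R_op X (fun g => f (merge_arg ord0 g))) g = fun y => 'D_(X : 'rV[R]_d)
  (fun z => v2r (f (cons_arg (chart_inv c1 z * chart_inv c1 y)%g g))) o by [].
apply/funext => y; rewrite {1}/first_slot R_opE r2vK first_slot_merge0.
by rewrite cons_arg0 cons_argS.
Qed.

Lemma R2_op_sym n X Y (f : ('I_n.+1 -> G) -> V) : smooth_vec f -> R2_op X Y f = R2_op Y X f.
Proof.
move=> sf; apply/funext => g; rewrite /R2_op.
have C := smooth1_coord (smooth1_slot g sf).
by rewrite (schwarz_mx _ _ (open_chart_img (c := c1)) chart_img_coord1 (C 2)).
Qed.

Lemma R_op_merge0 n (X Y : Lie G) (f : ('I_n.+1 -> G) -> V) : smooth_vec f ->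
  R_op Y (R_op X (fun g => f (merge_arg ord0 g))) = R2_op X Y f + R_op (mul_hessian X Y) f.
Proof.
move=> sf; apply/funext => g; rewrite R_opE.
by rewrite (@derive_val _ _ _ _ _ _ _ (R_op_R_op_merge0 X Y g sf)) v2rK.
Qed.
Lemma smooth_R2_R_op n (X Y Z : Lie G) (f : ('I_n.+1 -> G) -> V) : smooth_vec f ->
  smooth_vec (R2_op X Y f + R_op Z f).
Proof.
move=> sf; have := smooth_vec_lin 1 (smooth_R2_op X Y sf) (smooth_R_op Z sf).
by rewrite scale1r.
Qed.

Lemma prod_derivable_merge n (i : 'I_n) (X : 'I_n.+1 -> Lie G) (f : ('I_n -> G) -> V) :
  smooth_vec f -> prod_derivable X (fun g => f (merge_arg i g)).
Proof.
elim: n i X f => [[]//|n IH] i X f sf; case: (unliftP ord0 i) => [j|] ->.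
  split; last by rewrite R_op_mergeS; apply: IH; exact: smooth_R_op.
  move=> g; rewrite first_slot_mergeS; apply: diff_derivable; exact: smooth_derivable.
split.
  move=> g; rewrite first_slot_merge0.
  exact: (derivable_translate (smooth1_slot (g \o lift ord0) sf)).
split.
  by move=> g; have [] := R_op_R_op_merge0 (X ord0) (X (lift ord0 ord0)) g sf.
rewrite R_op_merge0//; apply: prod_derivable_smooth; exact: smooth_R2_R_op.
Qed.

Lemma R_prodS n (X : 'I_n.+1 -> Lie G) (f : ('I_n.+1 -> G) -> V) :
  R_prod X f = R_prod (X \o lift ord0) (R_op (X ord0) f).
Proof. by []. Qed.

(** Derivatives in slots before the merged pair pass by unchanged, which reduces to i = 0. There the
    terms [R2_op] cancel by symmetry, and the [mul_hessian] terms combine into the bracket by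
    linearity in the direction. *)
Lemma R_prod_merge_swap n (i : 'I_n) (X : 'I_n.+1 -> Lie G) (f : ('I_n -> G) -> V) :
  smooth_vec f ->
  R_prod X (fun g => f (merge_arg i g)) -
    R_prod (X \o tperm (lift ord_max i) (lift ord0 i)) (fun g => f (merge_arg i g)) =
  R_prod (merge_with (@Lie_bracket R d G) i X) f.
Proof.
elim: n i X f => [[]//|n IH] i X f sf; case: (unliftP ord0 i) => [j|] ->.
  (* The transposition fixes the first index and acts on the tail as the transposition for j. *)
  set t := tperm _ _; have t0 : t ord0 = ord0 by rewrite /t lift_maxS tpermD// eq_sym neq_lift.
  have tS : (X \o t) \o lift ord0 = (X \o lift ord0) \o tperm (lift ord_max j) (lift ord0 j).
    by apply/funext => k; rewrite /t /= lift_maxS (inj_tperm _ _ _ (@lift_inj _ ord0)).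
  rewrite -[in RHS](cons_argE X) merge_with_consS !R_prodS cons_arg0 cons_argS tS.
  by rewrite [(X \o t) ord0]/= t0 !R_op_mergeS IH//; exact: smooth_R_op.
rewrite -[in RHS](cons_argE X) merge_with_cons0 lift_max0 (R_prodS (cons_arg _ _)).
rewrite cons_arg0 cons_argS.
set t := tperm _ _; have tt : ((X \o t) \o lift ord0) \o lift ord0 =
    (X \o lift ord0) \o lift ord0.
  by apply/funext => k /=; rewrite /t tpermD.
rewrite !R_prodS tt !R_op_merge0// [(X \o t) ord0]/= [((X \o t) \o _) ord0]/=.
rewrite /t tpermL tpermR [(X \o lift ord0) ord0]/=.
rewrite (R2_op_sym _ _ sf) Lie_bracketE.
set A := R2_op _ _ f; set Y := X (lift _ _); set Z := (X \o lift ord0) \o lift ord0.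
have E : R_op (mul_hessian (X ord0) Y - mul_hessian Y (X ord0)) f =
   (-1) *: (A + R_op (mul_hessian Y (X ord0)) f) + (A + R_op (mul_hessian (X ord0) Y) f).
  rewrite [mul_hessian _ _ - _]addrC -scaleN1r R_op_lin_dir//.
  by rewrite scalerDr [RHS]addrACA [-1 *: A]scaleN1r addNr add0r.
rewrite E R_prod_lin; try exact/prod_derivable_smooth/smooth_R2_R_op.
by rewrite scaleN1r addrC.
Qed.

End Module.
End Terms.

(** * Sums over permutations *)

Section PermutationSums.
Context {R : realType} {V : lmodType R}.

(** A permutation amounts to the image j of p and a bijection u between the complements. Injectivity
    of this parametrization suffices, as both sides have (n + 1)! elements. *)
Lemma sum_lift_perm n (p : 'I_n.+1) (F : 'S_n.+1 -> V) :
  \sum_s F s = \sum_j \sum_(u : 'S_n) F (lift_perm p j u).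
Proof.
have inj : injective (fun ju : 'I_n.+1 * 'S_n => lift_perm p ju.1 ju.2).
  move=> [j u] [j' u'] /= /permP E; have := E p; rewrite !lift_perm_id => jj'.
  congr (_, _) => //; apply/permP => k; apply: (@lift_inj _ j).
  by have := E (lift p k); rewrite !lift_perm_lift jj'.
have card_le : (#|{: 'S_n.+1}| <= #|{: 'I_n.+1 * 'S_n}|)%N.
  by rewrite card_prod card_ord !card_Sn factS.
by rewrite pair_bigA/= (reindex _ (onW_bij _ (inj_card_bij inj card_le))).
Qed.

(** The same parametrization for the inverse permutation: here p is the preimage of j. *)
Lemma sum_lift_perm_inv n (j : 'I_n.+1) (F : 'S_n.+1 -> V) :
  \sum_s F s = \sum_p \sum_(u : 'S_n) F (lift_perm p j u).
Proof.
have inj_inv m : injective (fun s : 'S_m => s^-1%g) by exact: invg_inj.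
rewrite (reindex_inj (inj_inv _)) (sum_lift_perm j); apply: eq_bigr => p _.
by rewrite [RHS](reindex_inj (inj_inv _)); apply: eq_bigr => u _; rewrite lift_permV.
Qed.

(** The permutations s and [tperm p q * s] have opposite signs and exchanged values at p and q, so
    exactly one of each pair meets the condition. *)
Lemma sum_sign_tperm n (p q : 'I_n) (F : 'S_n -> V) : p != q ->
  \sum_(s : 'S_n) (-1) ^+ s *: F s =
  \sum_(s : 'S_n | (s p < s q)%N) (-1) ^+ s *: (F s - F (tperm p q * s)%g).
Proof.
move=> pq; rewrite (bigID (fun s : 'S_n => (s p < s q)%N))/=.
rewrite [X in _ + X](reindex_inj (mulgI (tperm p q)))/=.
rewrite [X in _ + X](eq_bigl (fun s : 'S_n => (s p < s q)%N)); last first.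
  move=> s; rewrite !permM tpermL tpermR -leqNgt leq_eqVlt.
  by rewrite (inj_eq val_inj) (inj_eq perm_inj) (negPf pq).
rewrite -big_split/=; apply: eq_bigr => s _.
by rewrite odd_permM odd_tperm pq/= signrN scalerBr scaleNr.
Qed.

Section MergeSum.
Context {L : Type} (br : L -> L -> L) (m : nat).
(** P k stands for the iterated derivative of the term merging slots k and k + 1, and A for that of
    f itself; PA is then [R_prod_merge_swap]. What remains is pure combinatorics. *)
Context (P : 'I_m.+1 -> ('I_m.+2 -> L) -> V) (A : ('I_m.+1 -> L) -> V).
Hypothesis PA : forall k X, P k X - P k (X \o tperm (lift ord_max k) (lift ord0 k)) =
  A (merge_with br k X).

Let bracket_arg (X : 'I_m.+2 -> L) (j : 'I_m.+2) (i : 'I_m.+1) : 'I_m.+1 -> L :=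
  cons_arg (br (X (lift j i)) (X j)) (X \o lift j \o lift i).

Lemma lift_max_lift0 (k : 'I_m.+1) : lift ord_max k = lift (lift ord0 k) k :> 'I_m.+2.
Proof.
apply/val_inj; rewrite /= /bump /= add1n ltnn add0n.
by rewrite leqNgt ltn_ord.
Qed.

(** The permutation on the left sends k + 1 to j and k to [lift j i], so merging puts the bracket of
    these two entries in slot k. On the right, [lift_perm k ord0 u] moves the bracket there from the
    front; u arranges the other entries on both sides. *)
Lemma merge_with_lift_perm (X : 'I_m.+2 -> L) k j i (u : 'S_m) :
  merge_with br k (X \o lift_perm (lift ord0 k) j (lift_perm k i u)) =
  bracket_arg X j i \o lift_perm k ord0 u.
Proof.
apply/funext => l; rewrite /merge_with /=.
case: (unliftP k l) => [l'|] ->; last first.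
  rewrite ltnn eqxx lift_max_lift0 lift_perm_lift !lift_perm_id.
  by rewrite /bracket_arg cons_arg0.
rewrite lift_perm_lift /bracket_arg /cons_arg liftK /=.
rewrite eq_sym (negPf (neq_lift _ _)).
(* Away from slot k, both branches of [merge_with] enumerate the indices other than k and k + 1. *)
have E : (if (lift k l' < k)%N then lift ord_max (lift k l') else lift ord0 (lift k l')) =
    lift (lift ord0 k) (lift k l') :> 'I_m.+2.
  apply/val_inj; have := ltn_ord l'; have := ltn_ord k.
  by case: ifP => /=; rewrite /bump /=; lia.
have -> : (if (lift k l' < k)%N
   then X (lift_perm (lift ord0 k) j (lift_perm k i u) (lift ord_max (lift k l')))
   else X (lift_perm (lift ord0 k) j (lift_perm k i u) (lift ord0 (lift k l')))) =
   X (lift_perm (lift ord0 k) j (lift_perm k i u) (lift (lift ord0 k) (lift k l'))).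
  by rewrite -E; case: ifP.
by rewrite !lift_perm_lift.
Qed.

Lemma sum_merge (X : 'I_m.+2 -> L) :
  \sum_(s : 'S_m.+2) (-1) ^+ s *: (\sum_(k < m.+1) (-1) ^+ k.+1 *: P k (X \o s)) =
  \sum_(j < m.+2) \sum_(i < m.+1 | (i < j)%N) (-1) ^+ (i + j) *:
    \sum_(t : 'S_m.+1) (-1) ^+ t *: A (bracket_arg X j i \o t).
Proof.
transitivity (\sum_(k < m.+1) (-1) ^+ k.+1 *: \sum_(s : 'S_m.+2) (-1) ^+ s *: P k (X \o s)).
  under eq_bigr do rewrite scaler_sumr; rewrite exchange_big/=; apply: eq_bigr => k _.
  by rewrite scaler_sumr; apply: eq_bigr => s _; rewrite !scalerA mulrC.
(* Pairing keeps the s with s(k) < s(k + 1). They are parametrized by j = s(k + 1), by i with s(k) =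
   [lift j i], and by u; the condition becomes i < j. *)
transitivity (\sum_(k < m.+1) \sum_(j < m.+2) \sum_(i < m.+1 | (i < j)%N) \sum_(u : 'S_m)
   (-1) ^+ (i + j) *:
     ((-1) ^+ (lift_perm k ord0 u) *: A (bracket_arg X j i \o lift_perm k ord0 u))).
  apply: eq_bigr => k _.
  have pq : lift ord_max k != lift ord0 k :> 'I_m.+2.
    by rewrite lift_max_lift0 eq_sym neq_lift.
  rewrite (sum_sign_tperm (fun s => P k (X \o s)) pq) big_mkcond/= (sum_lift_perm (lift ord0 k)).
  rewrite scaler_sumr; apply: eq_bigr => j _.
  rewrite (sum_lift_perm k) scaler_sumr [RHS]big_mkcond/=.
  apply: eq_bigr => i _; rewrite scaler_sumr lift_max_lift0.
  have ij : (lift j i < j)%N = (i < j)%N.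
    by rewrite /= /bump; case: (leqP j i) => ji; rewrite ?add0n ?ji// add1n ltnNge (leqW ji).
  rewrite -(lift_max_lift0 k).
  case: ifP => ij'; last first.
    rewrite big1// => u _; rewrite lift_max_lift0 lift_perm_lift !lift_perm_id ij ij'.
    by rewrite scaler0.
  apply: eq_bigr => u _; rewrite {1}lift_max_lift0 lift_perm_lift !lift_perm_id ij ij'.
  have -> : X \o
      (tperm (lift ord_max k) (lift ord0 k) * lift_perm (lift ord0 k) j (lift_perm k i u))%g =
     (X \o lift_perm (lift ord0 k) j (lift_perm k i u)) \o tperm (lift ord_max k) (lift ord0 k).
    by apply/funext => l /=; rewrite permM.
  rewrite PA merge_with_lift_perm !scalerA; congr (_ *: _).
  (* On the left the permutation has the parity of (k + 1) + j + k + i + u; with the factor of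
     exponent k + 1, both sides have the parity of k + i + j + u. *)
  rewrite -[_ ^+ k.+1]signr_odd -[_ ^+ (i + j)]signr_odd -!signr_addb.
  rewrite !odd_lift_perm oddD lift0 /=.
  by case: (odd k); case: (odd i); case: (odd j); case: (odd_perm u).
rewrite exchange_big/=; apply: eq_bigr => j _; rewrite exchange_big/=.
(* For fixed i and j, the slot k of the bracket and u together run once through all permutations. *)
apply: eq_bigr => i _; rewrite scaler_sumr (sum_lift_perm_inv ord0).
by apply: eq_bigr => k _.
Qed.
End MergeSum.
End PermutationSums.

(** * The van Est map and the differentials *)

Section VanEstCochainMap.
Context {R : realType} {d : nat} {G : lieGroupType R d}.
Local Notation c1 := (chart1 G).
Local Notation o := (coord1 G).

Section OneModule.
Context {V : vectType R}.

Lemma R_prod_lincomb n m (X : 'I_n -> Lie G) (a : 'I_m -> R) (F : 'I_m -> ('I_n -> G) -> V) :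
  (forall i, prod_derivable X (F i)) ->
  prod_derivable X (\sum_i a i *: F i) /\
  R_prod X (\sum_i a i *: F i) = \sum_i a i *: R_prod X (F i).
Proof.
move=> dF; have d0 : prod_derivable X (0 : ('I_n -> G) -> V).
  by apply: prod_derivable_smooth; have [] := gp_cochains0 G V n.
have R0 : R_prod X (0 : ('I_n -> G) -> V) = 0.
  have := R_prod_lin (-1) d0 d0; rewrite scaler0 addr0 scaleN1r addNr; exact.
elim: (index_enum _) => [|i r [IHd IHR]]; first by rewrite !big_nil.
rewrite !big_cons R_prod_lin// IHR; split=> //.
exact: prod_derivable_lin.
Qed.

Context (act : G -> V -> V) (dact : Lie G -> V -> V).
Hypothesis act_derive : forall X v, is_derive o (X : 'rV[R]_d)
  (fun z => v2r (act (chart_inv c1 z) v)) (v2r (dact X v)).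
Hypothesis dact_linear : forall X, linear (dact X).

Lemma R_prod_gp_diff n (X : 'I_n.+1 -> Lie G) (f : ('I_n -> G) -> V) : smooth_vec f ->
  prod_derivable X (gp_diff act f) /\
  R_prod X (gp_diff act f) = dact (X ord0) (R_prod (X \o lift ord0) f) +
    \sum_(i < n) (-1) ^+ i.+1 *: R_prod X (fun g => f (merge_arg i g)).
Proof.
move=> sf; have [d1 R1] := R_prod_first act_derive dact_linear X sf.
have [d3 R3] := R_prod_last X sf.
have [d2 R2] := @R_prod_lincomb _ n X (fun i => (-1) ^+ i.+1) (fun i g => f (merge_arg i g))
  (fun i => prod_derivable_merge i X sf).
set f1 := (fun g => act _ _) in d1 R1; set f3 := (fun g => _) in d3 R3.
have -> : gp_diff act f = (-1) ^+ n.+1 *: f3 +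
    (1 *: f1 + \sum_(i < n) (-1) ^+ i.+1 *: (fun g => f (merge_arg i g))).
  by apply/funext => g; rewrite /gp_diff addrC !fctE fct_sumE scale1r.
have d12 := prod_derivable_lin 1 d1 d2; split; first exact: prod_derivable_lin.
by rewrite R_prod_lin// R3 scaler0 add0r R_prod_lin// scale1r R1 R2.
Qed.

(** Splitting the sum by the image i of 0 under s turns the action terms into the first
    Chevalley-Eilenberg sum, with sign (-1)^i; [sum_merge] yields the bracket sum. *)
Lemma vanEst_gp_diff n (f : ('I_n -> G) -> V) : smooth_vec f ->
  vanEst (gp_diff act f) = CE_diff (@Lie_bracket R d G) dact (vanEst f).
Proof.
move=> sf; apply/funext => X; have linD Y := dact_linear Y.
pose D Y : {linear V -> V} := HB.pack (dact Y) (GRing.isLinear.Build R _ _ _ (dact Y) (linD Y)).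
have firstE : \sum_(s : 'S_n.+1) (-1) ^+ s *: dact (X (s ord0)) (R_prod ((X \o s) \o lift ord0) f) =
    \sum_(i < n.+1) (-1) ^+ i *: dact (X i) (vanEst f (X \o lift i)).
  rewrite (sum_lift_perm ord0); apply: eq_bigr => i _.
  rewrite /vanEst -[dact (X i)]/(D (X i) : V -> V) linear_sum scaler_sumr; apply: eq_bigr => u _.
  rewrite linearZ scalerA lift_perm_id odd_lift_perm /= signr_addb signr_odd.
  congr (_ *: dact _ (R_prod _ _)); apply/funext => k /=.
  by rewrite lift_perm_lift.
have -> : vanEst (gp_diff act f) X =
    \sum_(i < n.+1) (-1) ^+ i *: dact (X i) (vanEst f (X \o lift i)) +
    \sum_(s : 'S_n.+1) (-1) ^+ s *:
      \sum_(i < n) (-1) ^+ i.+1 *: R_prod (X \o s) (fun g => f (merge_arg i g)).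
  rewrite -firstE -big_split/=; apply: eq_bigr => s _.
  by have [_ ->] := R_prod_gp_diff (X \o s) sf; rewrite scalerDr.
(* In degree 0 there is nothing to merge, and [CE_diff] consists of the action term alone. *)
case: n f sf X {firstE} => [|n] f sf X.
  rewrite big_ord1 expr0 scale1r [X in _ + X]big1 ?addr0// => s _.
  by rewrite big_ord0 scaler0.
congr (_ + _).
exact: (@sum_merge R V (Lie G) (@Lie_bracket R d G) n
  (fun k Z => R_prod Z (fun g => f (merge_arg k g))) (fun Z => R_prod Z f)
  (fun k Z => R_prod_merge_swap k Z sf) X).
Qed.
End OneModule.

Lemma vanEst_linear (V W : vectType R) (A : {linear V -> W}) n (f : ('I_n -> G) -> V) :
  smooth_vec f -> vanEst (A \o f) = A \o (vanEst f : ('I_n -> Lie G) -> V).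
Proof.
move=> sf; apply/funext => X; rewrite /vanEst /= linear_sum; apply: eq_bigr => s _.
by have [_ ->] := R_prod_linear (linearP A) (prod_derivable_smooth (X \o s) sf); rewrite linearZ.
Qed.

Lemma vanEst_lin (V : vectType R) n a (f f' : ('I_n -> G) -> V) :
  (forall X, prod_derivable X f) -> (forall X, prod_derivable X f') ->
  vanEst (a *: f + f') = a *: (vanEst f : ('I_n -> Lie G) -> V) + vanEst f'.
Proof.
move=> df df'; apply/funext => X; rewrite !fctE /vanEst scaler_sumr -big_split/=.
by apply: eq_bigr => s _; rewrite R_prod_lin// scalerDr !scalerA mulrC.
Qed.

Lemma vanEst0 (V : vectType R) (f : ('I_0 -> G) -> V) :
  vanEst f = (fun=> f (fun=> 1%g)) :> (('I_0 -> Lie G) -> V).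
Proof.
apply/funext => X; rewrite /vanEst (big_pred1 (1%g : 'S_0)) ?odd_perm1 ?scale1r// => s.
by apply/esym/eqP/permP => -[].
Qed.
End VanEstCochainMap.

(** * The infinitesimal action as a derivative at the identity *)

Section Representations.
Context {R : realType} {d : nat} {G : lieGroupType R d} {V : vectType R}.
Context (e : exponential G) (r : lie_rep G V).
Local Notation c1 := (chart1 G).
Local Notation o := (coord1 G).

Lemma smooth1_rep v : smooth1 (fun g => rep_act r g v).
Proof.
move=> c ca k; pose L z := v2r ((r2v z : 'End(V)) v).
have linL : linear L.
  by move=> a y z; rewrite /L linearP /= add_lfunE scale_lfunE linearP.
pose L' : {linear _ -> _} := HB.pack L (GRing.isLinear.Build R _ _ _ L linL).
have -> : (fun z => v2r (rep_act r (chart_inv c z) v)) =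
    L' \o ((fun y => v2r (r (chart_inv_pow (fun _ : 'I_1 => c) y ord0))) \o id).
  by apply/funext => z; rewrite /= /L v2rK /chart_inv_pow row_id.
apply: class_C_linear; first exact: open_chart_img.
apply: (@class_C_affine R 'rV[R]_d 'rV[R]_d _ id id _ k _ _ _ _ _ (rep_smooth r (fun=> ca) k)).
- by [].
- by move=> y; exact: ex_diff.
- by move=> y yc i; rewrite row_id.
Qed.

(** Chain rule along the curve exp (t X), which passes through 1 with velocity X: its derivative is
    the directional derivative along X in the chart. *)
Lemma inf_action_derive (X : Lie G) v : is_derive o (X : 'rV[R]_d)
  (fun z => v2r (rep_act r (chart_inv c1 z) v)) (v2r (inf_action e r X v)).
Proof.
pose F := fun z => v2r (rep_act r (chart_inv c1 z) v).
have dF : differentiable F o.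
  exact: (class_Coo_differentiable (smooth1_coord (smooth1_rep v)) chart_img_coord1).
pose gamma := fun t : R^o => chart_map c1 (e (t *: X)).
have [oD Cg] := exp_smooth e X (@atlas_chart1 _ _ G).
have D0 : ([set: R^o] `&` (fun t : R^o => e (t *: X)) @^-1` chart_dom c1) 0.
  by split=> //=; rewrite scale0r exponential0; exact: chart_at_dom.
have dg : differentiable gamma 0 := class_Coo_differentiable Cg D0.
have g0 : gamma 0 = o by rewrite /gamma scale0r exponential0.
have gX : 'D_1 gamma 0 = X by rewrite -derive1E; exact: exp_velocity.
rewrite /inf_action r2vK derive1E.
have FE : {near (0 : R^o), F \o gamma =1 (fun t : R => v2r (rep_act r (e (t *: X)) v))}.
  apply: filterS (open_nbhs_nbhs (conj oD D0)) => t [_ /= Dt].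
  by rewrite /F /gamma /= chart_mapK.
rewrite -(near_eq_derive _ FE) derive_comp ?g0// gX.
exact/derivableP/diff_derivable.
Qed.
End Representations.

(** * Pullback along the Lie group homomorphism *)

Section Pullback.
Context {R : realType} {d e : nat} {G : lieGroupType R d} {H : lieGroupType R e}.
Context (Phi : lie_hom G H).
Local Notation o := (coord1 G).

Lemma hom1 : Phi 1%g = 1%g.
Proof. by have := homM Phi 1%g 1%g; rewrite mulg1 -{1}[Phi 1%g]mulg1 => /mulgI. Qed.

Context {W : vectType R}.

Lemma is_derive_pullback (phi : H -> W) (X : Lie G) : smooth1 phi ->
  is_derive o (X : 'rV[R]_d) (fun z => v2r (phi (Phi (chart_inv (chart1 G) z))))
   ('D_(Lie_map Phi X : 'rV[R]_e) (fun z => v2r (phi (chart_inv (chart1 H) z))) (coord1 H)).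
Proof.
move=> sphi; pose F z := v2r (phi (chart_inv (chart1 H) z)).
pose P z := chart_map (chart1 H) (Phi (chart_inv (chart1 G) z)).
pose c := fun _ : 'I_1 => chart1 G.
have [oD CP] := @hom_smooth _ _ _ _ _ Phi c (fun=> atlas_chart1) _ (@atlas_chart1 _ _ H).
set D := (X in open X) in oD; have Do : D o.
  split; first by move=> i; rewrite row_id; exact: chart_img_coord1.
  rewrite /preimage /= /chart_inv_pow row_id chart_inv_coord1 hom1; exact: chart_at_dom.
have PE : chart_map (chart1 H) \o ((fun x : 'I_1 -> G => Phi (x ord0)) \o chart_inv_pow c) = P.
  by apply/funext => z; rewrite /P /= /chart_inv_pow row_id.
rewrite PE in CP; have dP : differentiable P o := class_Coo_differentiable CP Do.
have P1 : P o = coord1 H by rewrite /P chart_inv_coord1 hom1.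
have dF : differentiable F (P o).
  by rewrite P1; exact: (class_Coo_differentiable (smooth1_coord sphi) chart_img_coord1).
have FE : {near o, F \o P =1 (fun z => v2r (phi (Phi (chart_inv (chart1 G) z))))}.
  apply: filterS (open_nbhs_nbhs (conj oD Do)) => z [_].
  by rewrite /preimage /= /chart_inv_pow row_id /F /P /= => Dz; rewrite chart_mapK.
apply: (near_eq_is_derive FE); have -> : Lie_map Phi X = 'D_(X : 'rV[R]_d) P o by [].
rewrite -P1 -derive_comp//; apply/derivableP/diff_derivable; exact: differentiable_comp.
Qed.

(** The chain rule applies slot by slot: after one derivative the function is again a pullback,
    namely of a cochain differentiated along [Lie_map Phi (X ord0)]. *)
Lemma R_prod_pullback n (X : 'I_n -> Lie G) (f : ('I_n -> H) -> W) : smooth_vec f ->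
  prod_derivable X (fun g => f (Phi \o g)) /\
  R_prod X (fun g => f (Phi \o g)) = R_prod (Lie_map Phi \o X) f.
Proof.
elim: n X f => [|n IH] X f sf.
  by split=> //=; congr (f _); apply/funext => i; exact: hom1.
have slotE g : first_slot (fun g => f (Phi \o g)) g =
    fun z => v2r (f (cons_arg (Phi (chart_inv (chart1 G) z)) (Phi \o g))).
  by apply/funext => z; rewrite /first_slot map_cons_arg.
have dS g := is_derive_pullback (X ord0) (smooth1_slot (Phi \o g) sf).
have E : R_op (X ord0) (fun g => f (Phi \o g)) =
    fun g => R_op (Lie_map Phi (X ord0)) f (Phi \o g).
  by apply/funext => g; rewrite !R_opE slotE (@derive_val _ _ _ _ _ _ _ (dS g)).
have [pd pR] := IH (X \o lift ord0) _ (smooth_R_op (Lie_map Phi (X ord0)) sf).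
rewrite !R_prodS E pR; split=> //; split; last by rewrite E.
by move=> g; rewrite slotE; have [] := dS g.
Qed.

Lemma vanEst_pullback n (f : ('I_n -> H) -> W) (X : 'I_n -> Lie G) : smooth_vec f ->
  vanEst (fun g => f (Phi \o g)) X = vanEst f (Lie_map Phi \o X).
Proof.
by move=> sf; apply: eq_bigr => s _; have [_ ->] := R_prod_pullback (X \o s) sf.
Qed.

Lemma prod_derivable_pullback n (X : 'I_n -> Lie G) (f : ('I_n -> H) -> W) : smooth_vec f ->
  prod_derivable X (fun g => f (Phi \o g)).
Proof. by move=> sf; have [] := R_prod_pullback X sf. Qed.
End Pullback.

(** * The induced map in cohomology *)

Section InducedMap.
Context {R : realType} {C D : cochain_complex R}.
Context (F : forall n, ambient C n -> ambient D n).
Hypothesis mapF : cochain_map F.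

Lemma cochain_map0 n : F (0 : ambient C n) = 0.
Proof.
have [_ linF _] := mapF; have := linF n (-1) 0 0 (cochains0 C n) (cochains0 C n).
by rewrite scaler0 addr0 scaleN1r addNr.
Qed.

Lemma cochain_map_cocycle n (z : cocycle C n) : F (cocycle_val z) \in @cocycles R D n.
Proof.
have [cF _ dF] := mapF; case: z => z /= /asboolP[cz dz].
by apply/asboolP; split; [exact: cF|rewrite -dF// dz cochain_map0].
Qed.

Definition cocycle_map n (z : cocycle C n) : cocycle D n :=
  Cocycle (cochain_map_cocycle z).

Lemma cocycle_cochain n (z : cocycle C n) : cochains (cocycle_val z).
Proof. by case: z => z /= /asboolP[]. Qed.

Lemma cocycle_map_linear n : linear (@cocycle_map n).
Proof.
have [_ linF _] := mapF => a z t; apply/val_inj.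
rewrite [RHS]linearP /= -linF; try exact: cocycle_cochain.
by congr F; exact: (linearP (\val : cocycle C n -> _) a z t).
Qed.

Lemma coh_class_map n (z t : cocycle C n) : coh_class z = coh_class t ->
  coh_class (cocycle_map z) = coh_class (cocycle_map t).
Proof.
have [cF _ dF] := mapF.
move/eqP; rewrite coh_classE => /asboolP zt; apply/eqP; rewrite coh_classE.
have -> : cocycle_map z - cocycle_map t = cocycle_map (z - t).
  by rewrite addrC -scaleN1r -cocycle_map_linear scaleN1r addrC.
(* In degree 0 the only coboundary is 0, so that case is separate. *)
apply/asboolP; move: (z - t) zt => {z t}; case: n => [|n] w /=.
  by move=> w0; rewrite w0 cochain_map0.
by move=> [b cb ->]; exists (F b); [exact: cF|exact: dF].
Qed.

(** The map is computed on chosen representatives; [coh_class_map] makes it independent of the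
    choice, and linearity follows. *)
Lemma cochain_map_cohomology n :
  exists Fn : {linear cohomology C n -> cohomology D n},
    forall z : cocycle C n, exists z' : cocycle D n,
      cocycle_val z' = F (cocycle_val z) /\ Fn (coh_class z) = coh_class z'.
Proof.
pose rep (x : cohomology C n) : cocycle C n :=
  repr (x : {ideal_quot @coboundaries R C n}).
have repK x : coh_class (rep x) = x by rewrite /coh_class reprK.
pose Fn x := coh_class (cocycle_map (rep x)).
have FnE z : Fn (coh_class z) = coh_class (cocycle_map z).
  by apply: coh_class_map; rewrite repK.
have linFn : linear Fn.
  move=> a x y; have [z ->] := coh_class_surj x; have [t ->] := coh_class_surj y.
  rewrite [a *: coh_class z]coh_classZ coh_classD !FnE cocycle_map_linear.
  by rewrite [a *: coh_class _]coh_classZ coh_classD.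
pose L : {linear cohomology C n -> cohomology D n} :=
  HB.pack Fn (GRing.isLinear.Build R _ _ _ Fn linFn).
exists L => z.
by exists (cocycle_map z); split=> //=; rewrite FnE.
Qed.
End InducedMap.

(** * The connecting component and the cochain map *)

Lemma vanEst_connecting (R : realType) (d e : nat)
    (G : lieGroupType R d) (H : lieGroupType R e) (Phi : lie_hom G H) (V W : vectType R)
    (psi : {linear V -> W}) (act : G -> W -> W) (dact : Lie G -> W -> W) n
    (T : ('I_n.+1 -> G) -> V) (Ga : ('I_n.+1 -> H) -> W) (L : ('I_n -> G) -> W) :
  (forall X w, is_derive (coord1 G) (X : 'rV[R]_d)
    (fun z => v2r (act (chart_inv (chart1 G) z) w)) (v2r (dact X w))) ->
  (forall X, linear (dact X)) ->
  smooth_vec T -> smooth_vec Ga -> smooth_vec L ->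
  vanEst (fun g => psi (T g) - Ga (Phi \o g) - gp_diff act L g) =
  (fun X => psi (vanEst T X) - vanEst Ga (Lie_map Phi \o X)
     - CE_diff (@Lie_bracket R d G) dact (vanEst L) X).
Proof.
move=> actP linP sT sG sL.
have dT (X : 'I_n.+1 -> Lie G) := (R_prod_linear (linearP psi) (prod_derivable_smooth X sT)).1.
have dG (X : 'I_n.+1 -> Lie G) := prod_derivable_pullback Phi X sG.
have dL (X : 'I_n.+1 -> Lie G) := (R_prod_gp_diff actP linP X sL).1.
(* [vanEst_lin] asks only for the existence of the iterated derivatives, which is what is known for
   [gp_diff act L] and for the pullback of Ga. *)
rewrite (_ : (fun g => _) = (-1) *: gp_diff act L +
  ((-1) *: (fun g => Ga (Phi \o g)) + (psi \o T))); last first.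
  by apply/funext => g; rewrite !fctE !scaleN1r [RHS]addrC [X in _ = X - _]addrC.
rewrite vanEst_lin//; last by move=> X; exact: prod_derivable_lin.
rewrite vanEst_lin// (vanEst_gp_diff actP linP)// vanEst_linear//.
apply/funext => X; rewrite !fctE vanEst_pullback// !scaleN1r.
by rewrite addrC [X in X - _ = _]addrC.
Qed.

Theorem theorem7p2 (R : realType) (d e : nat)
    (G : lieGroupType R d) (H : lieGroupType R e) (Phi : lie_hom G H)
    (expG : exponential G) (expH : exponential H)
    (V W : vectType R) (rV : lie_rep G V) (rW : lie_rep H W)
    (psi : 'Hom(V, W))
    (hpsi : forall (g : G) (v : V), psi (rV g v) = rW (Phi g) (psi v)) :
  let CG := mLG_complex Phi rV rW psi in
  let CA := mLA_complex (@Lie_bracket R d G) (@Lie_bracket R e H)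
              (Lie_map Phi) psi
              (inf_action_linear expG rV) (inf_action_linear expH rW) in
  cochain_map (C := CG) (D := CA) (@mvE R d e G H V W) /\
  forall n : nat,
    exists F : {linear cohomology CG n -> cohomology CA n},
      forall z : cocycle CG n, exists z' : cocycle CA n,
        cocycle_val z' = mvE (cocycle_val z) /\
        F (coh_class z) = coh_class z'.
Proof.
move=> CG CA.
suff mapE : cochain_map (C := CG) (D := CA) (@mvE R d e G H V W).
  by split=> // n; exact: (cochain_map_cohomology mapE).
have actV X v := inf_action_derive expG rV X v.
have actW X w := inf_action_derive expH rW X w.
(* Differentiating the action of G on W through Phi gives the action of Lie G through [Lie_map Phi],
   again by the chain rule. *)
have actWPhi X w : is_derive (coord1 G) (X : 'rV[R]_d)
    (fun z => v2r ((rep_act rW \o Phi) (chart_inv (chart1 G) z) w))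
    (v2r ((inf_action expH rW \o Lie_map Phi) X w)).
  have := is_derive_pullback Phi X (smooth1_rep rW w).
  by rewrite (@derive_val _ _ _ _ _ _ _ (actW (Lie_map Phi X) w)).
have linV := inf_action_linear expG rV; have linW := inf_action_linear expH rW.
have linWPhi X : linear ((inf_action expH rW \o Lie_map Phi) X) by exact: linW.
split.
- case=> [//|n] x [[sT _] [sG _] [sL _]]; split; exact: vanEst_CE.
- case=> [//|n] a [[T G'] L] [[T' G''] L'] [[sT _] [sG _] [sL _]] [[sT' _] [sG' _] [sL' _]].
  congr (_, _, _); apply: vanEst_lin => X; exact: prod_derivable_smooth.
(* In degree 0 the vectors v and psi v become functions of no arguments, which [vanEst] leaves
   unchanged. *)
case=> [v _|n [[T Ga] L] [[sT _] [sG _] [sL _]]].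
  have sv (d' : nat) (K : lieGroupType R d') (U : vectType R) (u : U) :
      smooth_vec (fun _ : 'I_0 -> K => u).
    by move=> c _ k; exact: class_C_cst.
  congr (_, _, _).
  - by rewrite (vanEst_gp_diff actV linV (sv _ _ _ _)) vanEst0.
  - by rewrite (vanEst_gp_diff actW linW (sv _ _ _ _)) vanEst0.
  - by rewrite vanEst0.
congr (_, _, _).
- exact: (vanEst_gp_diff actV linV).
- exact: (vanEst_gp_diff actW linW).
exact: (vanEst_connecting Phi psi actWPhi linWPhi sT sG sL).
Qed.
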